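(* Let $\mathcal{H}$ be a real Hilbert space, let $\rho\in\mathbb{R}$, let $\mathcal{A}:\mathcal{H}\to 2^{\mathcal{H}}$ be maximally $\rho$-comonotone with $\operatorname{zer}\mathcal{A}\neq\emptyset$, and let $\eta>\max\{-2\rho,0\}$. Let $\alpha,\beta\in\mathbb{R}$ and $t_0>0$. Then for any $x_0,x_1\in\mathcal{H}$ there exists a unique strong global solution $x:[t_0,+\infty)\to\mathcal{H}$ of the dynamical system $$\mu(t)=\mathcal{A}_\eta x(t),\qquad \ddot{x}(t)+\dot{\mu}(t)+\frac{\alpha}{t}\dot{x}(t)+\frac{\beta}{t}\mu(t)=0,$$ satisfying the Cauchy data $x(t_0)=x_0$ and $\dot{x}(t_0)=x_1$.
   Context: An operator $\mathcal{A}:\mathcal{H}\to 2^{\mathcal{H}}$ has graph $\operatorname{gra}\mathcal{A}=\{(x,u): u\in\mathcal{A}x\}$ and zero set $\operatorname{zer}\mathcal{A}=\{x: 0\in\mathcal{A}x\}$. It is $\rho$-comonotone if $\langle x-y,u-v\rangle\ge\rho\|u-v\|^2$ for all $(x,u),(y,v)\in\operatorname{gra}\mathcal{A}$, and maximally $\rho$-comonotone if moreover no $\rho$-comonotone operator has a graph properly containing $\operatorname{gra}\mathcal{A}$. For $\gamma>0$, the resolvent is $J_\gamma^{\mathcal{A}}=(Id+\gamma\mathcal{A})^{-1}$ and the Yosida regularization is $\mathcal{A}_\gamma=\frac1\gamma(Id-J_\gamma^{\mathcal{A}})$. When $\mathcal{A}$ is maximally $\rho$-comonotone and $\gamma>\max\{-2\rho,0\}$,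 both are single-valued and defined on all of $\mathcal{H}$. A strong global solution with Cauchy data $x(t_0)=x_0$, $\dot x(t_0)=x_1$ is a map $x:[t_0,+\infty)\to\mathcal{H}$ such that $x$ and $\dot x$ are locally absolutely continuous (absolutely continuous on each compact interval $[t_0,b]$), the two equations of the system hold for almost every $t\in[t_0,+\infty)$, and $x(t_0)=x_0$, $\dot x(t_0)=x_1$. *)

(* Defs.v *)
From HB Require Import structures.
From mathcomp Require Import all_boot all_order all_algebra.
From mathcomp Require Import all_classical all_reals all_analysis.

Set Implicit Arguments.
Unset Strict Implicit.
Unset Printing Implicit Defensive.

Import Order.TTheory GRing.Theory Num.Theory.
Import numFieldNormedType.Exports.

Local Open Scope classical_set_scope.
Local Open Scope ring_scope.

(* A real Hilbert space is a complete normed module H over R : realType whose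
   norm is induced by a positive definite symmetric bilinear form on H. *)
Definition norm_induced_by (R : realType) (H : normedModType R)
    (ip : {dot H for idfun}) : Prop :=
  forall x : H, `|x| ^+ 2 = ip x x.

Section Operators.
Context {R : realType} {H : normedModType R}.
Implicit Types (A B : H -> set H) (rho gamma : R).

Definition gra A : set (H * H) := [set p | A p.1 p.2].

Definition zer A : set H := [set x | A x 0].

Definition comonotone (ip : {dot H for idfun}) rho A : Prop :=
  forall x u y v : H, gra A (x, u) -> gra A (y, v) ->
    rho * `|u - v| ^+ 2 <= ip (x - y) (u - v).

Definition maximally_comonotone (ip : {dot H for idfun}) rho A : Prop :=
  comonotone ip rho A /\
  ~ exists2 B, comonotone ip rho B & gra A `<` gra B.

Definition id_plus_scaled gamma A : H -> set H :=
  fun x => [set x + gamma *: u | u in A x].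

Definition inverse_op A : H -> set H := fun y => [set x | A x y].

Definition resolvent gamma A : H -> set H := inverse_op (id_plus_scaled gamma A).

Definition yosida gamma A : H -> set H :=
  fun x => [set gamma^-1 *: (x - p) | p in resolvent gamma A x].

End Operators.

Section Curves.
Context {R : realType} {H : normedModType R}.
Implicit Types (f : R -> H) (D : set R).

(* Derivatives relative to D: the increments h are those with h + t in D, so
   on [t0, +oo[ this is the right derivative at t0 and, by derive_on_interior
   below, the usual derivative at every t > t0. *)
Definition derivable_on D f (t : R) : Prop :=
  cvg (h^-1 *: (f (h + t) - f t) @[h --> within [set h | D (h + t)] 0^']).

Definition derive_on D f (t : R) : H :=
  lim (h^-1 *: (f (h + t) - f t) @[h --> within [set h | D (h + t)] 0^']).

Lemma derive_on_interior D f t : nbhs t D ->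
  derivable_on D f t = derivable f t 1 /\ derive_on D f t = derive1 f t.
Proof.
move=> Dt.
have E : within [set h | D (h + t)] (0 : R)^' = (0 : R)^'.
  apply/seteqP; split => P /=; last first.
    by rewrite /within /= => P0; apply: filterS P0 => h Ph _.
  rewrite /within /= => P0.
  have D0 : \forall h \near (0 : R)^', D (h + t).
    apply: cvg_within.
    have : (h + t) @[h --> (0 : R)] --> t.
      by rewrite -[X in _ --> X]add0r; apply: cvgD; [exact: cvg_id|exact: cvg_cst].
    exact.
  by apply: filterS2 P0 D0 => h; apply.
have Q : (fun h : R => h^-1 *: (f (h *: (1 : R) + t) - f t)) =
         (fun h : R => h^-1 *: (f (h + t) - f t)).
  by apply/funext => h; rewrite [h *: (1 : R)]mulr1.
split; last by rewrite /derive_on E.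
rewrite /derivable_on E /derivable.
by rewrite /= -Q.
Qed.

Definition abs_continuous (a b : R) f : Prop :=
  forall e : R, 0 < e -> exists2 d : R, 0 < d &
    forall (n : nat) (u v : 'I_n -> R),
      (forall i, a <= u i /\ u i <= v i /\ v i <= b) ->
      trivIset setT (fun i => `]u i, v i[%classic) ->
      \sum_(i < n) (v i - u i) < d ->
      \sum_(i < n) `|f (v i) - f (u i)| < e.

Definition locally_abs_continuous (t0 : R) f : Prop :=
  forall b : R, t0 <= b -> abs_continuous t0 b f.

End Curves.

Section StrongSolution.
Context {R : realType} {H : normedModType R}.

(* x and mu are defined on all of R, but only their values on [t0, +oo[ are
   constrained. The Yosida regularization is set-valued here: the equation
   mu(t) = A_eta x(t) says that A_eta x(t) is the singleton {mu(t)}. *)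
Definition solves_system (A : H -> set H) (eta alpha beta t0 : R)
    (x mu : R -> H) (t : R) : Prop :=
  let I := `[t0, +oo[%classic in
  let dx := derive_on I x in
  [/\ yosida eta A (x t) = [set mu t],
      derivable_on I dx t,
      derivable_on I mu t &
      derive_on I dx t + derive_on I mu t
        + (alpha / t) *: dx t + (beta / t) *: mu t = 0].

Definition strong_global_solution (A : H -> set H) (eta alpha beta t0 : R)
    (x0 x1 : H) (x : R -> H) : Prop :=
  let I := `[t0, +oo[%classic in
  [/\ locally_abs_continuous t0 x,
      forall t, I t -> derivable_on I x t,
      locally_abs_continuous t0 (derive_on I x),
      exists mu : R -> H, \forall t \ae (@lebesgue_measure R),
        I t -> solves_system A eta alpha beta t0 x mu t &
      x t0 = x0 /\ derive_on I x t0 = x1].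

End StrongSolution.

(* Main.v *)
Require Import Defs.
From mathcomp Require Import all_boot all_order all_algebra.
From mathcomp Require Import all_classical all_reals all_analysis.
From mathcomp Require Import finmap measurable_realfun.
From mathcomp Require Import ring lra.
Import Order.TTheory GRing.Theory Num.Theory.
Import numFieldNormedType.Exports.
Local Open Scope classical_set_scope.
Local Open Scope ring_scope.

(** Why the theorem holds.

    The operator. Write [M] for the Yosida regularization [A_eta]. An element
    [u] is the value of [M] at [y] exactly when [y = x + eta u] for some [x]
    with [u] in [A x]. In the coordinates [v = (rho + eta) u] and
    [w = x + eta u - y - v] the graph of [A] is a maximal monotone graph, and
    [u] is found where that graph meets the antidiagonal [w = - v]. Such a
    point exists by Minty's theorem ([minty]), proved as Simons and Zalinescu
    do, by minimizing the Fitzpatrick function plus a square. Comonotonicity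
    also makes [M] cocoercive, hence Lipschitz ([yosida_lipschitz]).

    The equation. Integrating it once, by parts in the term [(alpha / t) x'],
    gives
      [x' + M x + (alpha / t) x = c - int_t0^t (alpha / s^2 x + beta / s M x)]
    where [c] is fixed by the Cauchy data. No derivative of [x] is left on the
    right, so a second integration turns the system into a fixed-point problem
    [x = T x] for continuous curves, with a Volterra operator [T] built from
    Lipschitz maps. In a norm weighted by a large exponential [T] halves
    distances ([picard_halving]), whence exactly one fixed point on the whole
    half line.

    From the fixed point to a strong solution ([fixpoint_strong_solution]).
    The fixed point is of class C^1 and its derivative is locally Lipschitz;
    the second-order equation asks in addition that [M x] have a derivative
    almost everywhere, although [M] is merely Lipschitz. This rests on the fact
    that a Lipschitz curve [f] in a Hilbert space is differentiable almost
    everywhere ([lipschitz_ae_derivable]). The additive function of intervals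
    [energy], the integral of [|f'|^2] in disguise, is almost exhausted by the
    chords of a fine enough chain of points. By orthogonality, the energy that
    the chords miss is the energy of the distance from [f] to its piecewise
    affine interpolant; a Vitali covering argument for nondecreasing functions
    ([steep_points_measure]) then bounds the measure of the points at which the
    difference quotients of [f] oscillate.

    From a strong solution to the fixed point ([strong_solution_fixpoint]). The
    difference of the two sides of the integrated equation is absolutely
    continuous with a derivative that vanishes almost everywhere, hence
    constant ([abs_continuous_derive0]), and the Cauchy data make it zero.

    Integrals of curves are defined weakly: the antiderivative of a continuous
    curve represents, in the sense of Riesz, the integrals of its scalar
    products ([exists_antiderivative]). *)

Set Implicit Arguments.
Unset Strict Implicit.
Unset Printing Implicit Defensive.

(** * Inner products *)

Section InnerProduct.
Context {R : realType} {H : normedModType R}.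
Variables (ip : {dot H for idfun}) (ipN : norm_induced_by ip).
Implicit Types (u v w : H) (a : R).

Lemma ipC u v : ip u v = ip v u.
Proof. by rewrite (hermC ip u v) /= expr0 mul1r. Qed.

Lemma ipDl u v w : ip (u + v) w = ip u w + ip v w.
Proof. exact: linearDl. Qed.
Lemma ipDr u v w : ip u (v + w) = ip u v + ip u w.
Proof. exact: linearDr. Qed.
Lemma ipNl u v : ip (- u) v = - ip u v.
Proof. exact: linearNl. Qed.
Lemma ipNr u v : ip u (- v) = - ip u v.
Proof. exact: linearNr. Qed.
Lemma ipZl a u v : ip (a *: u) v = a * ip u v.
Proof. exact: linearZl_LR. Qed.
Lemma ipZr a u v : ip u (a *: v) = a * ip u v.
Proof. by rewrite ipC ipZl ipC. Qed.
Lemma ip0l u : ip 0 u = 0. Proof. exact: linear0l. Qed.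
Lemma ip0r u : ip u 0 = 0. Proof. exact: linear0r. Qed.

Definition ipE := (ipDl, ipDr, ipNl, ipNr, ipZl, ipZr).

Lemma normr_ip u : `|u| ^+ 2 = ip u u. Proof. exact: ipN. Qed.

Lemma ip_cauchy_schwarz u v : ip u v <= `|u| * `|v|.
Proof.
have [->|v0] := eqVneq v 0; first by rewrite ip0r normr0 mulr0.
have [->|u0] := eqVneq u 0; first by rewrite ip0l normr0 mul0r.
have nu : 0 < `|u| by rewrite normr_gt0.
have nv : 0 < `|v| by rewrite normr_gt0.
have : 0 <= `| `|v| *: u - `|u| *: v | ^+ 2 by exact: sqr_ge0.
rewrite normr_ip !ipE (ipC v u) -!normr_ip => h.
have : `|u| * `|v| * ip u v <= `|u| * `|v| * (`|u| * `|v|) by nra.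
by rewrite ler_pM2l ?mulr_gt0.
Qed.

Lemma ip_norm_le u v : `|ip u v| <= `|u| * `|v|.
Proof.
rewrite ler_norml ip_cauchy_schwarz andbT.
by rewrite lerNl -ipNl -(normrN u) ip_cauchy_schwarz.
Qed.

Lemma ip_ext (u v : H) : (forall w, ip u w = ip v w) -> u = v.
Proof.
move=> h; apply/eqP; rewrite -subr_eq0 -normr_eq0 -sqrf_eq0.
by rewrite (normr_ip) ipDl ipNl h subrr.
Qed.

(** By polarization, the form inherits its continuity from the norm. *)
Lemma ip_cvg (T : Type) (F : set_system T) {FF : Filter F} (f g : T -> H) u v :
  f x @[x --> F] --> u -> g x @[x --> F] --> v ->
  ip (f x) (g x) @[x --> F] --> ip u v.
Proof.
move=> fu gv.
have E x y : ip x y = (`|x + y| ^+ 2 - `|x - y| ^+ 2) / 4.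
  by rewrite !normr_ip !ipE (ipC y x); field.
rewrite E (_ : (fun x => _) = fun x =>
    (`|f x + g x| * `|f x + g x| - `|f x - g x| * `|f x - g x|) / 4); last first.
  by apply/funext => x; rewrite E !expr2.
rewrite !expr2; apply: cvgMl; apply: cvgB.
  by apply: cvgM; apply: cvg_norm; apply: cvgD.
by apply: cvgM; apply: cvg_norm; apply: cvgB.
Qed.

End InnerProduct.


(** * Proximal points of closed convex epigraphs *)

(** Completeness in the form that serves both minimizing sequences and
    difference quotients: at each scale the values must cluster around some
    point, and nothing is asked of the dependence of that point on the scale. *)
Lemma cvg_near_constant {R : realType} {H : completeNormedModType R}
    (T : Type) (F : set_system T) (FF : ProperFilter F) (f : T -> H) :
  (forall e : R, 0 < e -> exists l : H, \forall x \near F, `|f x - l| <= e) ->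
  cvg (f @ F).
Proof.
move=> h; apply/cauchy_cvgP/cauchy_exP => e e0.
have [l hl] := h (e / 2) (divr_gt0 e0 (ltr0n _ 2)).
exists l; apply: filterS hl => x hx; rewrite -ball_normE /= distrC.
by rewrite (le_lt_trans hx)// ltr_pdivrMr// ltr_pMr// ltr1n.
Qed.

Section Proximal.
Context {R : realType} {H : completeNormedModType R}.
Variables (ip : {dot H for idfun}) (ipN : norm_induced_by ip).

Let ipS := ipC ip.
Let nip := normr_ip ipN.

(** Twice the objective [c + |u|^2 / 2 + |x|^2 / 2] of the proximal problem. *)
Definition penalized (u x : H) (c : R) := 2 * c + `|u| ^+ 2 + `|x| ^+ 2.

Variable S : H -> H -> R -> Prop.
Hypothesis S_nonempty : exists u x c, S u x c.
Hypothesis S_convex : forall u x c v w d (t : R), 0 <= t -> t <= 1 ->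
  S u x c -> S v w d ->
  S (u + t *: (v - u)) (x + t *: (w - x)) (c + t * (d - c)).
Hypothesis S_closed : forall (u x : nat -> H) (c : nat -> R) v w d,
  u @ \oo --> v -> x @ \oo --> w -> c @ \oo --> d ->
  (forall n, S (u n) (x n) (c n)) -> S v w d.
Variable b : R.
Hypothesis S_bounded : forall u x c, S u x c -> b <= penalized u x c.

Let values := [set r | exists u x c, S u x c /\ r = penalized u x c].
Let m := inf values.

Let values_inf : has_inf values.
Proof.
split; first by have [u [x [c Suxc]]] := S_nonempty; exists (penalized u x c), u, x, c.
by exists b => _ [u [x [c [Suxc ->]]]]; exact: S_bounded.
Qed.

Let m_le u x c : S u x c -> m <= penalized u x c.
Proof. by move=> Suxc; apply: (inf_lbound values_inf.2); exists u, x, c. Qed.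

(* The midpoint is still in [S], so that the parallelogram law bounds the
   distance of two points by their excess over the infimum. *)
Let dist_le u x c v w d : S u x c -> S v w d ->
  `|u - v| ^+ 2 + `|x - w| ^+ 2 <=
  2 * (penalized u x c - m) + 2 * (penalized v w d - m).
Proof.
move=> Su Sv; have h : 0 <= 2^-1 :> R by [].
have h1 : 2^-1 <= 1 :> R by lra.
have /m_le := S_convex h h1 Su Sv; rewrite /penalized !nip !ipE (ipS v u) (ipS w x).
by move=> ?; lra.
Qed.

Lemma penalized_min : exists u x c,
  S u x c /\ forall v w d, S v w d -> penalized u x c <= penalized v w d.
Proof.
have ex n : exists p : H * H * R, S p.1.1 p.1.2 p.2 /\
    penalized p.1.1 p.1.2 p.2 <= m + n.+1%:R^-1.
  have n0 : 0 < n.+1%:R^-1 :> R by rewrite invr_gt0.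
  have [_ [u [x [c [Suxc ->]]]] hl] := inf_adherent n0 values_inf.
  by exists ((u, x), c); split => //; exact: ltW.
have [p hp] := choice ex.
have cau (f : nat -> H) : (forall n k,
    `|f n - f k| ^+ 2 <= 2 * n.+1%:R^-1 + 2 * k.+1%:R^-1) -> cvgn f.
  move=> hf; apply: cvg_near_constant => e e0.
  have e20 : 0 < e ^+ 2 / 4 by rewrite divr_gt0// exprn_gt0.
  have [N _ hN] := (cvgrPdist_le _ _).1 (@cvg_harmonic R) _ e20.
  exists (f N); exists N => // n /= Nn.
  rewrite -ler_sqr ?nnegrE ?(ltW e0)// (le_trans (hf _ _))//.
  have := hN _ Nn; have := hN _ (leqnn N).
  rewrite !sub0r !normrN !ger0_norm ?harmonic_ge0// /harmonic /= => h1 h2.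
  rewrite [leRHS](_ : _ = 2 * (e ^+ 2 / 4) + 2 * (e ^+ 2 / 4)); last by field.
  by rewrite lerD// ler_pM2l.
have cu : cvgn (fun n => (p n).1.1).
  apply: cau => n k /=; have := dist_le (hp n).1 (hp k).1.
  have := (hp n).2; have := (hp k).2.
  have := sqr_ge0 `|(p n).1.2 - (p k).1.2|. 
  by move: n.+1%:R^-1 k.+1%:R^-1 => a1 a2; lra.
have cx : cvgn (fun n => (p n).1.2).
  apply: cau => n k /=; have := dist_le (hp n).1 (hp k).1.
  have := (hp n).2; have := (hp k).2.
  have := sqr_ge0 `|(p n).1.1 - (p k).1.1|.
  by move: n.+1%:R^-1 k.+1%:R^-1 => a1 a2; lra.
set u := limn _ in cu; set x := limn _ in cx.
have cv : (fun n => penalized (p n).1.1 (p n).1.2 (p n).2) @ \oo --> m.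
  apply: (@squeeze_cvgr _ _ _ _ (fun=> m) (fun n => m + n.+1%:R^-1)).
  - by apply: nearW => n; rewrite (m_le (hp n).1) (hp n).2.
  - exact: cvg_cst.
  - by rewrite -[X in _ --> X]addr0; apply: cvgD; [exact: cvg_cst|exact: cvg_harmonic].
pose c := (m - `|u| ^+ 2 - `|x| ^+ 2) / 2.
have cc : (fun n => (p n).2) @ \oo --> c.
  rewrite (_ : (fun n => _) = fun n => (penalized (p n).1.1 (p n).1.2 (p n).2
     - `|(p n).1.1| * `|(p n).1.1| - `|(p n).1.2| * `|(p n).1.2|) / 2); last first.
    by apply/funext => n; rewrite /penalized; field.
  rewrite /c !expr2; apply: cvgMl; apply: cvgB; first apply: cvgB => //.
    by apply: cvgM; apply: cvg_norm.
  by apply: cvgM; apply: cvg_norm.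
have Suxc : S u x c by apply: (S_closed cu cx cc) => n; exact: (hp n).1.
exists u, x, c; split => // v w d /m_le; apply: le_trans.
by rewrite /penalized /c; lra.
Qed.

(** A minimizing sequence is Cauchy by uniform convexity of the square of the
    norm, so its limit is a minimizer. Comparing it with the points of a segment
    that leaves it towards [(v, w, d)], to first order in the length of the
    segment, gives the stated variational inequality. With two vector
    components, one statement covers functions on [H] and on [H * H]. *)
Lemma proximal_point : exists u x c,
  S u x c /\ forall v w d, S v w d -> c <= d + ip u (v - u) + ip x (w - x).
Proof.
have [u [x [c [Suxc hmin]]]] := penalized_min.
exists u, x, c; split => // v w d Svwd.
set q := d + _ + _; set r := `|v - u| ^+ 2 + `|w - x| ^+ 2.
have r0 : 0 <= r by rewrite addr_ge0// sqr_ge0.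
have ht (t : R) : 0 < t -> t <= 1 -> c <= q + t * r.
  move=> t0 t1; have := hmin _ _ _ (S_convex (ltW t0) t1 Suxc Svwd).
  rewrite /penalized !nip => h.
  have : 0 <= t * (2 * (q - c) + t * r).
    rewrite /q /r !nip; move: h; rewrite !ipE (ipS v u) (ipS w x); nra.
  by rewrite pmulr_rge0//; nra.
apply/ler_addgt0Pr => e e0.
(* [t * r <= e] *)
pose t := Num.min 1 (e / (r + 1)).
have r1 : 0 < r + 1 by rewrite ltr_wpDl.
have t0 : 0 < t by rewrite lt_min ltr01 divr_gt0.
rewrite (le_trans (ht t t0 _)) ?ge_min ?lexx// lerD2l.
rewrite (@le_trans _ _ (e / (r + 1) * r))// ?ler_wpM2r ?ge_min ?lexx ?orbT//.
by rewrite mulrAC ler_pdivrMr// ler_pM2l// lerDl.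
Qed.

End Proximal.

(** * Riesz representation, Minty surjectivity, Yosida regularization *)

Section Riesz_Minty.
Context {R : realType} {H : completeNormedModType R}.
Variables (ip : {dot H for idfun}) (ipN : norm_induced_by ip).

Let ipS := ipC ip.
Let nip := normr_ip ipN.

(** The vector sought minimizes [|u|^2 / 2 - l u]. It is the proximal point of
    the epigraph of [- l], with the second component held at [0]. *)
Lemma riesz_representation (l : H -> R) (K : R) :
  (forall a v w, l (a *: v + w) = a * l v + l w) ->
  (forall w, `|l w| <= K * `|w|) ->
  exists u, forall w, ip u w = l w.
Proof.
move=> lin bnd.
have lD v w : l (v + w) = l v + l w by rewrite -[v]scale1r lin mul1r scale1r.
have l0 : l 0 = 0 by have := lD 0 0; rewrite addr0; lra.
have lZ a w : l (a *: w) = a * l w by rewrite -[a *: w]addr0 lin l0 addr0.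
have lN w : l (- w) = - l w by rewrite -scaleN1r lZ mulN1r.
have lcont (u : nat -> H) v : u @ \oo --> v -> (l \o u) @ \oo --> l v.
  move=> uv;
  have cd : (fun n => K * `|u n - v|) @ \oo --> (0 : R).
    rewrite -(mulr0 K); apply: cvgMr; rewrite -(normr0 H) -(subrr v).
    by apply: cvg_norm; apply: cvgB => //; exact: cvg_cst.
  apply: (@squeeze_cvgr _ _ _ _ (fun n => l v - K * `|u n - v|)
    (fun n => l v + K * `|u n - v|)).
  - apply: nearW => n /=; have := bnd (u n - v); rewrite lD lN ler_norml.
    by move=> /andP[? ?]; apply/andP; split; lra.
  - by rewrite -[X in _ --> X]subr0; apply: cvgB => //; exact: cvg_cst.
  - by rewrite -[X in _ --> X]addr0; apply: cvgD => //; exact: cvg_cst.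
pose S (u x : H) c := x = 0 /\ - l u <= c.
have [u [_ [c [[-> uc] hu]]]] : exists u x c, S u x c /\
    forall v w d, S v w d -> c <= d + ip u (v - u) + ip x (w - x).
  apply: (@proximal_point _ _ _ ipN S _ _ _ (- K ^+ 2)).
  - by exists 0, 0, 0; split => //; rewrite l0 oppr0.
  - move=> u x c v w d t t0 t1 [-> uc] [-> vd].
    rewrite subrr scaler0 addr0; split => //.
    rewrite lD lZ lD lN; nra.
  - move=> u x c v w d uv xw cd h; split.
      have x0 : x = fun=> 0 by apply/funext => n; rewrite (h n).1.
      by rewrite -(cvg_lim (@norm_hausdorff _ H) xw) x0 lim_cst.
    have lu : (fun n => - l (u n)) @ \oo --> - l v by apply: cvgN; exact: lcont.
    by apply: (ler_cvg_to lu cd); apply: nearW => n; rewrite (h n).2.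
  - move=> u x c [-> uc]; rewrite /penalized normr0 expr0n addr0.
    have := le_trans (ler_norm _) (bnd u).
    by have := sqr_ge0 (`|u| - K); rewrite !expr2; lra.
exists u => w.
have h v : 0 <= ip u v - l v.
  have := hu (u + v) 0 (- l (u + v)) (conj erefl (lexx _)).
  by rewrite ip0l addr0 (addrC u v) addrK lD; lra.
apply: le_anti; have := h w; have := h (- w); rewrite ipNr lN => ? ?.
by apply/andP; split; lra.
Qed.

(** [S] is the epigraph of the Fitzpatrick function of [G]. This function lies
    above the duality product, by maximality, and equals it on [G], by
    monotonicity. At its proximal point [(u, x)] the variational inequality
    tested on [G] says that [(- x, - u)] is monotonically related to [G], hence
    belongs to it; tested on this very point, it gives [u + x = 0]. *)
Lemma minty (G : H -> H -> Prop) :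
  (exists v w, G v w) ->
  (forall v w v' w', G v w -> G v' w' -> 0 <= ip (v - v') (w - w')) ->
  (forall v w, (forall v' w', G v' w' -> 0 <= ip (v - v') (w - w')) -> G v w) ->
  exists v, G v (- v).
Proof.
move=> [v0 [w0 Gvw0]] Gmono Gmax.
pose S (u x : H) c := forall v w, G v w -> ip u w + ip v x - ip v w <= c.
have SG v w : G v w -> S v w (ip v w).
  by move=> Gvw v' w' Gvw'; have := Gmono _ _ _ _ Gvw Gvw'; rewrite !ipE; lra.
have ipS_le u x c : S u x c -> ip u x <= c.
  move=> Suxc; have [/Suxc|nG] := pselect (G u x); first lra.
  have [v [w [Gvw h]]] : exists v w, G v w /\ ip (u - v) (x - w) < 0.
    apply: contrapT => h; apply: nG; apply: Gmax => v w Gvw.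
    by rewrite leNgt; apply/negP => ?; apply: h; exists v, w.
  by have := Suxc _ _ Gvw; move: h; rewrite !ipE; lra.
have [u [x [c [Suxc hu]]]] : exists u x c, S u x c /\
    forall v w d, S v w d -> c <= d + ip u (v - u) + ip x (w - x).
  apply: (@proximal_point _ _ _ ipN S _ _ _ 0).
  - by exists v0, w0, (ip v0 w0); exact: SG.
  - move=> u x c v w d t t0 t1 Su Sv v' w' Gv'; have := Su _ _ Gv'; have := Sv _ _ Gv'.
    by rewrite !ipE; nra.
  - move=> u x c v w d uv xw cd h v' w' Gv'.
    have cuw : (fun n => ip (u n) w') @ \oo --> ip v w'.
      exact: (ip_cvg ipN uv (cvg_cst w')).
    have cvx : (fun n => ip v' (x n)) @ \oo --> ip v' w.
      exact: (ip_cvg ipN (cvg_cst v') xw).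
    have cl : (fun n => ip (u n) w' + ip v' (x n) - ip v' w') @ \oo -->
      ip v w' + ip v' w - ip v' w'.
      by apply: cvgB; [exact: cvgD|exact: cvg_cst].
    apply: (ler_cvg_to cl cd); apply: nearW => n; exact: h.
  - move=> u x c /ipS_le; rewrite /penalized !nip.
    by have := sqr_ge0 `|u + x|; rewrite nip !ipE (ipS x u); lra.
have key v w : G v w -> `|u + x| ^+ 2 <= ip (v + x) (w + u).
  move=> Gvw; have := hu _ _ _ (SG _ _ Gvw); have := ipS_le _ _ _ Suxc.
  by rewrite nip !ipE (ipS x u) (ipS v u); lra.
have GN : G (- x) (- u).
  apply: Gmax => v w /key; have := sqr_ge0 `|u + x|.
  by rewrite !ipE; lra.
have : `|u + x| ^+ 2 <= 0.
  by rewrite (le_trans (key _ _ GN))// addNr ip0l.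
rewrite exprn_even_le0//= normr_eq0 addr_eq0 => /eqP ux.
by exists u; rewrite {1}ux.
Qed.

(** Otherwise the pair [(x, u)] could be added to the graph. *)
Lemma maximally_comonotone_mem (rho : R) (A : H -> set H) x u :
  maximally_comonotone ip rho A ->
  (forall y v, A y v -> rho * `|u - v| ^+ 2 <= ip (x - y) (u - v)) -> A x u.
Proof.
move=> [Amon Amax] h; apply: contrapT => nA; apply: Amax.
exists (fun y => [set v | A y v \/ (y = x /\ v = u)]); last first.
  split=> [[y v] /= ?|/(_ (x, u))]; first by left.
  by move=> /(_ (or_intror (conj erefl erefl))).
move=> y v y' v'; rewrite /gra /= => -[Ayv|[-> ->]] -[Ayv'|[-> ->]].
- exact: Amon.
- have := h _ _ Ayv; rewrite -normrN opprB -(opprB v) -(opprB y) ipNl ipNr opprK.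
  by [].
- exact: h.
- by rewrite !subrr normr0 expr0n mulr0 ip0l.
Qed.

Lemma yosida_lipschitz (rho eta : R) (A : H -> set H) :
  maximally_comonotone ip rho A -> (exists x u, A x u) -> Num.max (- 2 * rho) 0 < eta ->
  exists2 M : H -> H, (forall y, yosida eta A y = [set M y]) &
    forall y z, `|M y - M z| <= (rho + eta)^-1 * `|y - z|.
Proof.
move=> Amax [x0 [u0 Axu0]]; rewrite gt_max => /andP[eta_rho eta0].
have k0 : 0 < rho + eta by lra.
have Amon := Amax.1.
have surj y : exists u, exists2 x, A x u & x + eta *: u = y.
  (* In these coordinates the graph of [A] is maximal monotone, and its points
     with [w = - v] are those with [x + eta *: u = y]. *)
  pose G (v w : H) := exists x u,
    [/\ A x u, v = (rho + eta) *: u & w = x + eta *: u - y - v].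
  have [|||v [x [u [Axu vE wE]]]] := @minty G.
  - by exists ((rho + eta) *: u0), (x0 + eta *: u0 - y - (rho + eta) *: u0), x0, u0.
  - move=> _ _ _ _ [x [u [Axu -> ->]]] [x' [u' [Axu' -> ->]]].
    rewrite -scalerBr ipZl pmulr_rge0//; have := Amon _ _ _ _ Axu Axu'.
    rewrite nip !ipE (ipS u' u) (ipS u x) (ipS u' x) (ipS u x') (ipS u' x').
    by lra.
  - move=> v w; have [u ->] : exists u : H, v = (rho + eta) *: u.
      by exists ((rho + eta)^-1 *: v); rewrite scalerA divff ?scale1r ?gt_eqF.
    move=> h; exists (w + (rho + eta) *: u + y - eta *: u), u.
    split => //; last by rewrite subrK addrK addrK.
    apply: (maximally_comonotone_mem Amax) => x' u' Axu'.
    have := h _ _ (ex_intro _ x' (ex_intro _ u' (And3 Axu' erefl erefl))).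
    rewrite -scalerBr ipZl pmulr_rge0// nip.
    rewrite !ipE (ipS u' u) (ipS u w) (ipS u' w) (ipS u y) (ipS u' y).
    rewrite (ipS u x') (ipS u' x').
    by lra.
  exists u, x => //; apply/eqP; rewrite -subr_eq0; apply/eqP.
  by apply: (addIr (- v)); rewrite -wE add0r.
have uniq y z u v x x' : A x u -> A x' v -> x + eta *: u = y -> x' + eta *: v = z ->
    `|u - v| <= (rho + eta)^-1 * `|y - z|.
  move=> Axu Axv <- <-; rewrite ler_pdivlMl//.
  have [->|uv] := eqVneq u v; first by rewrite subrr normr0 mulr0.
  rewrite -(ler_pM2r (_ : 0 < `|u - v|)) ?normr_gt0 ?subr_eq0//.
  apply: le_trans (ip_cauchy_schwarz ipN _ _).
  have := Amon _ _ _ _ Axu Axv; rewrite -mulrA -expr2 nip.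
  by rewrite !ipE (ipS v u); lra.
pose M y := sval (cid (surj y)).
have MP y : exists2 x, A x (M y) & x + eta *: M y = y := svalP (cid (surj y)).
exists M => [y|y z]; last first.
  have [x Ax xy] := MP y; have [x' Ax' xz] := MP z.
  exact: uniq Ax Ax' xy xz.
have etaK v : eta^-1 *: (eta *: v) = v by rewrite scalerA mulVf ?scale1r ?gt_eqF.
have [x Ax xy] := MP y; apply/seteqP; split => [_ [p [u Apu pu] <-]|_ ->].
  have := uniq _ _ _ _ _ _ Apu Ax pu xy.
  rewrite subrr normr0 mulr0 normr_le0 subr_eq0 => /eqP <-.
  by rewrite -pu addrAC subrr add0r etaK.
by exists x; [exists (M y)|rewrite -{1}xy addrAC subrr add0r etaK].
Qed.

End Riesz_Minty.

(** * Almost everywhere differentiability of Lipschitz curves *)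

Section MonotoneMaximal.
Context {R : realType}.
Notation mu := (@lebesgue_measure R).
Implicit Types (F : R -> R) (a b c : R).

Definition nondecreasing_on a b F :=
  forall s t, a <= s -> s <= t -> t <= b -> F s <= F t.

(** Each of the remaining intervals lies to the left or to the right of the
    first one, and both groups are handled by induction on their number. *)
Lemma disjoint_increments_le (I : eqType) (u v : I -> R) F (D : seq I) a b :
  nondecreasing_on a b F -> a <= b -> uniq D ->
  (forall i, i \in D -> [/\ a <= u i, u i < v i & v i <= b]) ->
  (forall i j, i \in D -> j \in D -> i != j -> v i <= u j \/ v j <= u i) ->
  \sum_(i <- D) (F (v i) - F (u i)) <= F b - F a.
Proof.
have [n] := ubnP (size D); elim: n => // n IH in D a b *.
case: D => [|i D] /= sD Fnd ab.
  by rewrite big_nil subr_ge0 => *; apply: Fnd.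
move=> /andP[iD uD] hD sep.
have [aui uvi vib] := hD i (mem_head _ _).
rewrite big_cons (bigID (fun j => v j <= u i)) /= -!(big_filter D).
have hl : \sum_(j <- [seq j <- D | v j <= u i]) (F (v j) - F (u j)) <= F (u i) - F a.
  apply: IH => //.
  - by rewrite size_filter (leq_ltn_trans (count_size _ _)).
  - by move=> s t as_ st tu; apply: Fnd => //; lra.
  - exact: filter_uniq.
  - move=> j; rewrite mem_filter => /andP[vu jD].
    by have [] := hD j; rewrite ?inE ?jD ?orbT.
  - move=> j k; rewrite !mem_filter => /andP[_ jD] /andP[_ kD].
    by apply: sep; rewrite inE ?jD ?kD orbT.
have hr : \sum_(j <- [seq j <- D | ~~ (v j <= u i)]) (F (v j) - F (u j)) <= F b - F (v i).
  apply: IH => //.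
  - by rewrite size_filter (leq_ltn_trans (count_size _ _)).
  - by move=> s t as_ st tu; apply: Fnd => //; lra.
  - exact: filter_uniq.
  - move=> j; rewrite mem_filter => /andP[/negP vu jD].
    have [] := hD j; rewrite ?inE ?jD ?orbT// => ? ? ?; split => //.
    have ij : i != j by apply: contraNneq iD => ->.
    by have [] := sep i j (mem_head _ _) _ ij; rewrite ?inE ?jD ?orbT.
  - move=> j k; rewrite !mem_filter => /andP[_ jD] /andP[_ kD].
    by apply: sep; rewrite inE ?jD ?kD orbT.
by lra.
Qed.

Definition steep_points a b F c : set R :=
  [set t | exists u v, [/\ a <= u, u < t < v, v <= b & c * (v - u) < F v - F u]].

Lemma steep_points_open a b F c : open (steep_points a b F c).
Proof.
rewrite (_ : steep_points _ _ _ _ = \bigcup_(p in [set p : R * R |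
    [/\ a <= p.1, p.2 <= b & c * (p.2 - p.1) < F p.2 - F p.1]]) `]p.1, p.2[%classic).
  by apply: bigcup_open => p _; exact: interval_open.
apply/seteqP; split => t /=.
  by move=> [u [v [? ? ? ?]]]; exists (u, v); rewrite //= in_itv.
by move=> [[u v] /= [? ? ?]]; rewrite in_itv/= => ?; exists u, v.
Qed.

(** The maximal inequality for the measure [dF]. A compact set of steep points
    is covered by finitely many intervals on which [F] grows at a rate above
    [c]. Vitali's lemma extracts disjoint ones whose threefold dilations still
    cover, and the increments of [F] over disjoint intervals add up to at most
    [F b - F a]. *)
Lemma steep_points_measure a b F c : a <= b -> nondecreasing_on a b F -> 0 < c ->
  (mu (steep_points a b F c) <= (3 / c * (F b - F a))%:E)%E.
Proof.
move=> ab Fnd c0.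
have oS := @steep_points_open a b F c.
rewrite lebesgue_regularity_inner_sup; last exact: open_measurable.
apply: ge_ereal_sup => _ /= [K [cK KS] <-].
set S := steep_points a b F c in KS oS *.
have ex (t : R) : exists p : R * R, p.1 < t < p.2 /\
    (S t -> [/\ a <= p.1, p.2 <= b & c * (p.2 - p.1) < F p.2 - F p.1]).
  have [[u [v [? ? ? ?]]]|nS] := pselect (S t); first by exists (u, v).
  by exists (t - 1, t + 1); split => //=; rewrite ltrDl gtrDl oppr_lt0 ltr01.
have [p hp] := choice ex.
pose u (t : R) := (p t).1; pose v (t : R) := (p t).2.
have utv (t : R) : u t < t < v t := (hp t).1.
have uv (t : R) : u t < v t by have /andP[? ?] := utv t; lra.
pose B (t : R) : set R := ball ((u t + v t) / 2) ((v t - u t) / 2).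
have BE (t : R) : B t = `]u t, v t[%classic.
  rewrite /B ball_itv (_ : _ - _ = u t); last by field.
  by rewrite (_ : (u t + v t) / 2 + _ = v t); last by field.
have r0 (t : R) : 0 < (v t - u t) / 2 by rewrite divr_gt0// subr_gt0.
have KB : K `<=` cover S B.
  by move=> t /KS St; exists t => //; rewrite BE /= in_itv/= utv.
have [D DS Dcover] : finite_subset_cover S B K.
  move: cK; rewrite compact_cover => /(_ _ _ _ _ KB); apply.
  by move=> t _; exact: ball_open.
have is_ballB (t : R) : is_ball (B t) by exact: is_ball_ball.
have Bset0 (t : R) : B t !=set0 by exists ((u t + v t) / 2); exact: ballxx.
have [E [uE ED tEB DE]] := @vitali_lemma_finite_cover _ _ B is_ballB Bset0 D.
have ES (t : R) : t \in E -> S t by move=> /ED /DS /set_mem.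
have muB (t : R) : mu (3 *` B t) = (3 * (v t - u t))%:E.
  rewrite scale_ballE// lebesgue_measure_ball; last by rewrite mulr_ge0// ltW.
  by congr (_%:E); rewrite -mulr_natr; field.
apply: (@le_trans _ _ (\sum_(t <- E) mu (3 *` B t))%E).
  have {}DE := subset_trans Dcover DE.
  rewrite (big_nth 0%R) big_mkord.
  apply: (@content_subadditive _ _ _ mu K (fun i => 3 *` B (nth 0%R E i)) (size E)).
  - by move=> k ?; rewrite scale_ballE//; exact: measurable_ball.
  - by apply: closed_measurable; apply: compact_closed => //; exact: Rhausdorff.
  - apply: (subset_trans DE); rewrite /cover bigcup_seq.
    by rewrite (big_nth 0%R)//= big_mkord.
under eq_bigr do rewrite muB.
rewrite sumEFin lee_fin -mulr_sumr -mulrA ler_pM2l// ler_pdivlMl// mulr_sumr.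
apply: le_trans (@disjoint_increments_le _ u v F E a b Fnd ab uE _ _).
- rewrite big_seq [leRHS]big_seq; apply: ler_sum => t /ES/(hp t).2[_ _].
  by move=> /ltW.
- by move=> t /ES /(hp t).2[? ? _].
- move=> s t sE tE st; apply: contrapT => /not_orP[/negP + /negP]; rewrite -!ltNge => h1 h2.
  have /eqP : s = t.
    apply: tEB => //; exists (Num.max (u s) (u t) / 2 + Num.min (v s) (v t) / 2).
    have := uv s; have := uv t; rewrite !BE /= !in_itv /= => ? ?.
    by case: (leP (u s) (u t)); case: (leP (v s) (v t)) => ? ?;
      split; apply/andP; split; lra.
  by rewrite (negPf st).
Qed.

End MonotoneMaximal.

Section Energy.
Context {R : realType} {H : normedModType R}.
Variables (ip : {dot H for idfun}) (ipN : norm_induced_by ip).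
Variables (f : R -> H) (L : R).
Hypothesis fL : forall s t, `|f t - f s| <= L * `|t - s|.

Let ipS := ipC ip.
Let nip := normr_ip ipN.
Implicit Types (r s t : R) (l : seq R).

Definition quotient_energy s t := `|f t - f s| ^+ 2 / (t - s).
Local Notation q := quotient_energy.

Lemma quotient_energy_le s t : s <= t -> q s t <= L ^+ 2 * (t - s).
Proof.
rewrite le_eqVlt => /predU1P[->|st]; first by rewrite /q !subrr invr0 !mulr0.
have st0 : 0 < t - s by rewrite subr_gt0.
rewrite /q ler_pdivrMr// -mulrA -expr2 -exprMn.
have := fL s t; rewrite gtr0_norm// => h.
by rewrite ler_sqr ?nnegrE//; apply: le_trans h.
Qed.

(** This is the convexity of the square: the gap between the two sides is the
    square of the norm of [(r - t) *: A - (t - s) *: B], up to a positive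
    factor. *)
Lemma quotient_energyD s t r : s <= t -> t <= r -> q s r <= q s t + q t r.
Proof.
rewrite le_eqVlt => /predU1P[->|st]; first by rewrite /q !subrr invr0 mulr0 add0r.
rewrite le_eqVlt => /predU1P[->|tr]; first by rewrite /q !subrr invr0 mulr0 addr0.
have st0 : 0 < t - s by rewrite subr_gt0.
have tr0 : 0 < r - t by rewrite subr_gt0.
have sr0 : 0 < r - s by lra.
rewrite /q ler_pdivrMr//.
set A := f t - f s; set B := f r - f t.
have -> : f r - f s = A + B by rewrite /A /B [RHS]addrC addrA subrK.
have h : 0 <= `|(r - t) *: A - (t - s) *: B| ^+ 2 / ((r - t) * (t - s)).
  by rewrite divr_ge0 ?sqr_ge0// mulr_ge0// ltW.
rewrite -subr_ge0; apply: le_trans h _; rewrite le_eqVlt; apply/orP; left; apply/eqP.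
rewrite !nip; move: A B => A B; rewrite !ipE (ipS B A); field.
by rewrite !gt_eqF.
Qed.

Fixpoint chain_energy s l :=
  if l is t :: l' then q s t + chain_energy t l' else 0.

Lemma chain_energy_cat s l1 l2 :
  chain_energy s (l1 ++ l2) = chain_energy s l1 + chain_energy (last s l1) l2.
Proof. by elim: l1 s => [|t l1 IH] s /=; rewrite ?add0r// IH addrA. Qed.

Lemma le_last s l : path <=%R s l -> s <= last s l.
Proof. by elim: l s => //= t l IH s /andP[st /IH]; exact: le_trans. Qed.

Lemma chain_energy_le s l : path <=%R s l ->
  chain_energy s l <= L ^+ 2 * (last s l - s).
Proof.
elim: l s => [|t l IH] s /=; first by rewrite subrr mulr0.
move=> /andP[st /IH]; have := quotient_energy_le st; lra.
Qed.

(** Inserting a point into a chain can only increase its energy. *)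
Lemma chain_energy_split s t l : path <=%R s l -> s <= t -> t <= last s l ->
  exists l1 l2, [/\ path <=%R s l1, last s l1 = t, path <=%R t l2,
    last t l2 = last s l & chain_energy s l <= chain_energy s l1 + chain_energy t l2].
Proof.
elim: l s => [|x l IH] s /=.
  move=> _ st ts; have -> : t = s by apply: le_anti; rewrite st ts.
  by exists [::], [::]; rewrite /= addr0.
move=> /andP[sx pl] st tl; have [tx|xt] := leP t x.
  exists [:: t], (x :: l); split; rewrite //= ?st// ?tx//.
  by have := quotient_energyD st tx; lra.
have [l1 [l2 [p1 e1 p2 e2 h]]] := IH x pl (ltW xt) tl.
by exists (x :: l1), l2; split; rewrite //= ?sx//; lra.
Qed.

Let energies s t :=
  [set chain_energy s l | l in [set l | path <=%R s l /\ last s l = t]].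

(** The integral of [|f'|^2] over [[s, t]], written without a derivative. *)
Definition energy s t := sup (energies s t).

Let energies_sup s t : s <= t -> has_sup (energies s t).
Proof.
move=> st; split; first by exists (chain_energy s [:: t]), [:: t]; rewrite //= andbT.
by exists (L ^+ 2 * (t - s)) => _ [l [pl <-] <-]; exact: chain_energy_le.
Qed.

Lemma chain_energy_le_energy s l : path <=%R s l ->
  chain_energy s l <= energy s (last s l).
Proof.
move=> pl; apply: (sup_ubound (energies_sup (le_last pl)).2).
by exists l.
Qed.

Lemma energy_approx s t e : s <= t -> 0 < e ->
  exists l, [/\ path <=%R s l, last s l = t & energy s t - e < chain_energy s l].
Proof.
by move=> st e0; have [_ [l [pl lt] <-] h] := sup_adherent e0 (energies_sup st);
  exists l.
Qed.

(** The one link between [f] and its energy that the covering argument uses: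
    squared increments are controlled by increments of an additive function. *)
Lemma quotient_energy_le_energy s t : s <= t -> q s t <= energy s t.
Proof.
move=> st; have := @chain_energy_le_energy s [:: t].
by rewrite /= andbT addr0; exact.
Qed.

Lemma energy_ge0 s t : s <= t -> 0 <= energy s t.
Proof.
move=> st; apply: le_trans (quotient_energy_le_energy st).
by rewrite /q divr_ge0 ?sqr_ge0// subr_ge0.
Qed.

Lemma energyD s t r : s <= t -> t <= r -> energy s r = energy s t + energy t r.
Proof.
move=> st tr; apply: le_anti; apply/andP; split; apply/ler_addgt0Pr => e e0.
  have [l [pl lr h]] := energy_approx (le_trans st tr) e0.
  have := @chain_energy_split s t l pl st; rewrite lr => /(_ tr).
  move=> [l1 [l2 [p1 e1 p2 e2 h']]].
  have := chain_energy_le_energy p1; have := chain_energy_le_energy p2.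
  by rewrite e1 e2; lra.
have e20 : 0 < e / 2 by rewrite divr_gt0.
have [l1 [p1 e1 h1]] := energy_approx st e20.
have [l2 [p2 e2 h2]] := energy_approx tr e20.
have := @chain_energy_le_energy s (l1 ++ l2).
rewrite cat_path p1 last_cat e1 e2 p2 chain_energy_cat e1 => /(_ isT).
lra.
Qed.

(** Up to an additive constant, and as a function of [t], the energy over
    [[s, t]] of the difference between [f] and its chord over [[s, r]]. *)
Definition defect s r t :=
  let m := (r - s)^-1 *: (f r - f s) in
  energy s t - 2 * ip m (f t) + `|m| ^+ 2 * t.

(** Expanding the square on the left gives the energy of the chord of [f] over
    [[u, v]] plus terms that are affine in [f] and in time. These are exactly
    the terms by which [defect] differs from [energy]. *)
Lemma defect_increment s r u v : s <= u -> u < v -> v <= r ->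
  `|f v - f u - (v - u) *: ((r - s)^-1 *: (f r - f s))| ^+ 2 <=
  (v - u) * (defect s r v - defect s r u).
Proof.
move=> su uv vr; have uv0 : 0 < v - u by rewrite subr_gt0.
have := quotient_energy_le_energy (ltW uv).
rewrite /q /defect (energyD su (ltW uv)) ler_pdivrMr//.
set m := (r - s)^-1 *: _; rewrite !nip; move: m => m.
rewrite !ipE (ipS (f v) m) (ipS (f u) m) (ipS (f u) (f v)).
by nra.
Qed.

Lemma defect_nondecreasing s r : nondecreasing_on s r (defect s r).
Proof.
move=> u v su; rewrite le_eqVlt => /predU1P[->//|uv] vr.
rewrite -subr_ge0 -(pmulr_rge0 _ (_ : 0 < v - u)) ?subr_gt0//.
by apply: le_trans (defect_increment su uv vr); exact: sqr_ge0.
Qed.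

(** The total defect of an interval is the energy that its chord misses. *)
Lemma defect_total s r : s < r ->
  defect s r r - defect s r s = energy s r - q s r.
Proof.
move=> sr; have sr0 : r - s != 0 by rewrite gt_eqF// subr_gt0.
have e0 : energy s s = 0.
  by have := energyD (lexx s) (lexx s); lra.
rewrite /defect /q e0 !nip !ipE (ipS (f s) (f r)); field.
exact: sr0.
Qed.

(** Points at which no vector approximates all small difference quotients up to
    [d]. In a complete space, [f] is differentiable at every point that is rough
    for no positive [d]. *)
Definition rough_points d : set R :=
  [set t | ~ exists m : H, \forall h \near (0 : R), `|f (h + t) - f t - h *: m| <= d * `|h|].

(** The slope of the chord over [[s, r]] serves as an approximate derivative
    at every point that is not steep for the defect. *)
Lemma rough_points_steep d s r : 0 < d ->
  rough_points d `&` `]s, r[ `<=` steep_points s r (defect s r) (d ^+ 2).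
Proof.
move=> d0 t [rt]; rewrite /= in_itv/= => /andP[st tr].
apply: contrapT => nst; apply: rt.
pose m := (r - s)^-1 *: (f r - f s); exists m.
have key u v : s <= u -> u < t -> t < v -> v <= r ->
    defect s r v - defect s r u <= d ^+ 2 * (v - u).
  move=> su ut tv vr; rewrite leNgt; apply/negP => h; apply: nst.
  by exists u, v; rewrite ut tv.
have d2 : 0 < d ^+ 2 by rewrite exprn_gt0.
(* Steep points are defined with intervals that contain [t] in their interior.
   Since the defect is monotone, the interval may be shrunk until [t] becomes an
   endpoint. *)
have right v : t < v -> v <= r -> defect s r v - defect s r t <= d ^+ 2 * (v - t).
  move=> tv vr; apply/ler_addgt0Pr => e e0.
  pose u := Num.max s (t - e / d ^+ 2).
  have ed : 0 < e / d ^+ 2 by rewrite divr_gt0.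
  have ut : u < t by rewrite gt_max st gtrBl.
  have su : s <= u by rewrite le_max lexx.
  have := key u v su ut tv vr.
  have := @defect_nondecreasing s r u t su (ltW ut) (ltW tr).
  have : t - e / d ^+ 2 <= u by rewrite le_max lexx orbT.
  rewrite lerBlDr -lerBlDl ler_pdivlMr//.
  by lra.
have left u : s <= u -> u < t -> defect s r t - defect s r u <= d ^+ 2 * (t - u).
  move=> su ut; apply/ler_addgt0Pr => e e0.
  pose v := Num.min r (t + e / d ^+ 2).
  have ed : 0 < e / d ^+ 2 by rewrite divr_gt0.
  have tv : t < v by rewrite lt_min tr ltrDl.
  have vr : v <= r by rewrite ge_min lexx.
  have := key u v su ut tv vr.
  have := @defect_nondecreasing s r t v (ltW st) (ltW tv) vr.
  have : v <= t + e / d ^+ 2 by rewrite ge_min lexx orbT.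
  rewrite -lerBlDl ler_pdivlMr//.
  by lra.
have e0 : 0 < Num.min (t - s) (r - t) by rewrite lt_min !subr_gt0 st.
exists (Num.min (t - s) (r - t)) => //= h; rewrite /= sub0r normrN lt_min => /andP[h1 h2].
rewrite -ler_sqr ?nnegrE ?mulr_ge0 ?(ltW d0)// exprMn.
have [h0|h0|->] := ltgtP h 0; last by rewrite add0r subrr scale0r subrr !normr0 expr0n mulr0.
  have sht : s <= h + t by move: h1; rewrite ltr0_norm//; lra.
  have ht : h + t < t by lra.
  have th : t - (h + t) = - h by ring.
  have -> : f (h + t) - f t - h *: m = - (f t - f (h + t) - (t - (h + t)) *: m).
    by rewrite th scaleNr opprK opprD opprB.
  rewrite normrN; apply: le_trans (defect_increment sht ht (ltW tr)) _.
  have := left _ sht ht; rewrite th ltr0_norm//.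
  by move: (defect s r t) (defect s r (h + t)) => *; nra.
have htr : h + t <= r by move: h2; rewrite gtr0_norm//; lra.
have ht : t < h + t by lra.
have th : h + t - t = h by ring.
rewrite -[X in X *: m]th; apply: le_trans (defect_increment (ltW st) ht htr) _.
have := right _ ht htr; rewrite th gtr0_norm//.
by move: (defect s r t) (defect s r (h + t)) => *; nra.
Qed.

End Energy.

Section LipschitzDifferentiability.
Context {R : realType} {H : completeNormedModType R}.
Variables (ip : {dot H for idfun}) (ipN : norm_induced_by ip).
Notation mu := (@lebesgue_measure R).
Implicit Types (f : R -> H) (a b d e : R).

Lemma small_cover_negligible (N : set R) :
  (forall e, 0 < e -> exists E : set R, [/\ measurable E, (mu E <= e%:E)%E & N `<=` E]) ->
  mu.-negligible N.
Proof.
move=> h.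
have ex n : exists E : set R,
    [/\ measurable E, (mu E <= (n.+1%:R^-1)%:E)%E & N `<=` E].
  by apply: h; rewrite invr_gt0.
have [E hE] := choice ex.
have mE : measurable (\bigcap_n E n) by apply: bigcapT_measurable => n; case: (hE n).
exists (\bigcap_n E n); split => //; last by move=> t Nt n _; case: (hE n) => _ _; exact.
apply/eqP; rewrite eq_le measure_ge0 andbT; apply/lee_addgt0Pr => e e0.
rewrite add0e.
have [n _ /(_ n (leqnn n))] := (cvgrPdist_le _ _).1 (@cvg_harmonic R) _ e0.
rewrite /= sub0r normrN ger0_norm ?harmonic_ge0// => hn.
have [mEn muEn _] := hE n.
apply: (@le_trans _ _ (mu (E n))).
  by apply: le_measure; [exact: mem_set|exact: mem_set|move=> t; apply].
by apply: le_trans muEn _; rewrite lee_fin.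
Qed.

(** Apply the maximal inequality to the defect on each link of the chain: the
    total defect of the links is the energy that the chain misses. *)
Lemma rough_points_chain f L d s l :
  (forall s t, `|f t - f s| <= L * `|t - s|) -> 0 < d -> path <=%R s l ->
  exists E : set R, [/\ measurable E,
    (mu E <= (3 / d ^+ 2 * (energy f s (last s l) - chain_energy f s l))%:E)%E &
    rough_points f d `&` `]s, last s l[ `<=` E].
Proof.
move=> fL d0; have d2 : 0 < d ^+ 2 by rewrite exprn_gt0.
elim: l s => [|r l IH] s /=.
  move=> _; exists set0; split => //; rewrite ?measure0.
    by rewrite subr0 lee_fin mulr_ge0 ?(energy_ge0 fL)// divr_ge0// ltW.
  by move=> t [_]; rewrite /= in_itv/= => /andP[]; lra.
move=> /andP[sr pl]; have [E [mE muE hE]] := IH r pl.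
have rl := le_last pl.
have eD := energyD ipN fL sr rl.
move: sr; rewrite le_eqVlt => /predU1P[rs|sr].
  exists E; split => //; rewrite rs//.
  by rewrite /quotient_energy !subrr invr0 mulr0 add0r.
have nd := @defect_nondecreasing R H ip ipN f L fL s r.
exists (steep_points s r (defect ip f s r) (d ^+ 2) `|` [set r] `|` E).
have mS : measurable (steep_points s r (defect ip f s r) (d ^+ 2)).
  by apply: open_measurable; exact: steep_points_open.
have mSr : measurable (steep_points s r (defect ip f s r) (d ^+ 2) `|` [set r]).
  exact: measurableU.
split; first exact: measurableU.
- apply: (le_trans (outer_measureU2 mu _ _)).
  apply: (le_trans (leeD (outer_measureU2 mu _ _) muE)).
  have muS := steep_points_measure (ltW sr) nd d2.
  apply: (le_trans (leeD (leeD muS (le_refl (mu [set r]))) (lexx _))).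
  rewrite [mu [set r]]lebesgue_measure_set1 adde0 -EFinD lee_fin.
  rewrite (defect_total ipN fL sr) -mulrDr.
  apply: ler_wpM2l; first by rewrite divr_ge0// ltW.
  by rewrite eD; lra.
- move=> t [rt]; rewrite /= in_itv/= => /andP[st tl].
  have [tr|rt'|->] := ltgtP t r; last by left; right.
    left; left; apply: (rough_points_steep ipN fL d0); split => //=.
    by rewrite in_itv/= st.
  by right; apply: hE; split => //=; rewrite in_itv/= rt'.
Qed.

(** A chain may be chosen to miss as little energy as desired. *)
Lemma rough_points_negligible f L d a b :
  (forall s t, `|f t - f s| <= L * `|t - s|) -> 0 < d -> a <= b ->
  mu.-negligible (rough_points f d `&` `]a, b[).
Proof.
move=> fL d0 ab; apply: small_cover_negligible => e e0.
have d2 : 0 < d ^+ 2 by rewrite exprn_gt0.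
have c0 : 0 < 3 / d ^+ 2 by rewrite divr_gt0.
have [l [pl lb hl]] := energy_approx fL ab (divr_gt0 e0 c0).
have [E [mE muE hE]] := rough_points_chain fL d0 pl.
exists E; split => //; last by rewrite -lb.
apply: (le_trans muE); rewrite lee_fin lb -ler_pdivlMl// mulrC.
by lra.
Qed.

Lemma not_rough_derivable f t :
  (forall n, ~ rough_points f n.+1%:R^-1 t) -> derivable f t 1.
Proof.
move=> h; apply: cvg_near_constant => e e0.
have [n _ /(_ n (leqnn n))] := (cvgrPdist_le _ _).1 (@cvg_harmonic R) _ e0.
rewrite /= sub0r normrN ger0_norm ?harmonic_ge0// /harmonic => hn.
have /contrapT[m hm] := h n.
exists m; near=> k.
have k0 : k != 0 by near: k; exact: nbhs_dnbhs_neq.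
have -> : k^-1 *: (f (k *: 1 + t) - f t) - m = k^-1 *: (f (k + t) - f t - k *: m).
  by rewrite [k *: 1]mulr1 [RHS]scalerBr scalerA mulVf// scale1r.
rewrite normrZ normfV.
rewrite ler_pdivrMl ?normr_gt0// mulrC.
have : `|f (k + t) - f t - k *: m| <= n.+1%:R^-1 * `|k|.
  by near: k; exact: cvg_within.
by move=> /le_trans; apply; rewrite ler_wpM2r.
Unshelve. all: by end_near. Qed.

(** Almost everywhere and at every scale [1 / n.+1] the difference quotients
    stay close to some vector, so they converge by completeness. *)
Lemma lipschitz_ae_derivable f L a b :
  (forall s t, `|f t - f s| <= L * `|t - s|) -> a <= b ->
  mu.-negligible (`]a, b[ `&` [set t | ~ derivable f t 1]).
Proof.
move=> fL ab.
have : mu.-negligible (\bigcup_n (rough_points f n.+1%:R^-1 `&` `]a, b[)).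
  apply: negligible_bigcup => n.
  by apply: (rough_points_negligible fL) => //; rewrite invr_gt0.
apply: negligibleS => t [tab]; apply: contra_notP => h.
apply: not_rough_derivable => n rt.
by apply: h; exists n.
Qed.

End LipschitzDifferentiability.

(** * Derivatives and antiderivatives of curves *)

Section Calculus.
Context {R : realType} {H : normedModType R}.
Implicit Types (f : R -> H) (s t : R).

Lemma is_derive_approxP f t (l : H) : is_derive t 1 f l <->
  (forall e, 0 < e -> \forall h \near (0 : R), `|f (h + t) - f t - h *: l| <= e * `|h|).
Proof.
have E h : h != 0 ->
    `|l - h^-1 *: (f (h *: 1 + t) - f t)| = `|h|^-1 * `|f (h + t) - f t - h *: l|.
  move=> h0; rewrite distrC [h *: 1]mulr1 -normfV -normrZ [in RHS]scalerBr scalerA.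
  by rewrite mulVf// scale1r.
split=> [[df dfl]|h].
  move=> e e0; have /cvgrPdist_le/(_ e e0) : (h^-1 *: (f (h *: 1 + t) - f t)) @[h --> 0^'] --> l.
    by rewrite -dfl; exact: df.
  rewrite near_withinE; apply: filterS => h hh.
  have [->|h0] := eqVneq h 0; first by rewrite add0r subrr scale0r subrr !normr0 mulr0.
  by have := hh h0; rewrite E// ler_pdivrMl ?normr_gt0// mulrC.
have cl : (h^-1 *: (f (h *: 1 + t) - f t)) @[h --> 0^'] --> l.
  apply/cvgrPdist_le => e e0; rewrite near_withinE; apply: filterS (h e e0) => k hk k0.
  by rewrite E// ler_pdivrMl ?normr_gt0// mulrC.
by split; [apply/cvg_ex; exists l|exact/cvg_lim].
Qed.

Lemma is_derive_continuous f t (l : H) : is_derive t 1 f l -> {for t, continuous f}.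
Proof. by move=> [df _]; apply: differentiable_continuous; exact/derivable1_diffP. Qed.

Lemma continuous_within (T : topologicalType) (f : R -> T) (D : set R) :
  (forall t, D t -> {for t, continuous f}) -> {within D, continuous f}.
Proof. by move=> h; apply: continuous_in_subspaceT => t /set_mem; exact: h. Qed.

Lemma nonneg_derive_le (p p' : R -> R) s t : s <= t ->
  {within `[s, t], continuous p} ->
  (forall r, s < r < t -> is_derive r 1 p (p' r) /\ 0 <= p' r) -> p s <= p t.
Proof.
move=> st cp dp.
have [||c cst E] := @MVT_segment _ p (fun r => if s < r < t then p' r else 0) s t st.
- by move=> r; rewrite in_itv /= => rst; rewrite rst; case: (dp r rst).
- exact: cp.
rewrite -subr_ge0 E mulr_ge0 ?subr_ge0//.
by case: ifPn => // /dp[].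
Qed.

End Calculus.

Section HilbertCalculus.
Context {R : realType} {H : normedModType R}.
Variables (ip : {dot H for idfun}) (ipN : norm_induced_by ip).
Implicit Types (f : R -> H) (s t : R).

Lemma continuous_ip f t w : {for t, continuous f} ->
  {for t, continuous (fun s => ip (f s) w)}.
Proof. by move=> cf; apply: (ip_cvg ipN cf); exact: cvg_cst. Qed.

Lemma is_derive_ip f t (l w : H) : is_derive t 1 f l ->
  is_derive t 1 (fun s => ip (f s) w) (ip l w).
Proof.
move=> /is_derive_approxP df; apply/is_derive_approxP => e e0.
have w1 : 0 < `|w| + 1 by rewrite ltr_wpDl.
have := df (e / (`|w| + 1)) (divr_gt0 e0 w1); apply: filterS => h hh.
have -> : ip (f (h + t)) w - ip (f t) w - h *: ip l w =
    ip (f (h + t) - f t - h *: l) w by rewrite !ipE.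
apply: (le_trans (ip_norm_le ipN _ _)).
apply: (le_trans (ler_wpM2r (normr_ge0 _) hh)).
rewrite mulrAC ler_wpM2r// mulrAC ler_pdivrMr//.
by rewrite ler_wpM2l ?lerDl// ltW.
Qed.

(** The mean value inequality is reduced to real functions by pairing the curve
    with its own increment. *)
Lemma mean_value_inequality f (f' : R -> H) (p p' : R -> R) s t : s <= t ->
  {within `[s, t], continuous f} -> {within `[s, t], continuous p} ->
  (forall r, s < r < t -> [/\ is_derive r 1 f (f' r), is_derive r 1 p (p' r) &
    `|f' r| <= p' r]) -> `|f t - f s| <= p t - p s.
Proof.
move=> st cf cp d; set w := f t - f s.
have [->|w0] := eqVneq w 0.
  rewrite normr0 subr_ge0; apply: (@nonneg_derive_le _ _ p') => // r /d[_ dp le].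
  by split => //; exact: le_trans le.
have nw : 0 < `|w| by rewrite normr_gt0.
have : `|w| * p s - ip (f s) w <= `|w| * p t - ip (f t) w.
  apply: (@nonneg_derive_le _ (fun r => `|w| * p r - ip (f r) w)
     (fun r => `|w| * p' r - ip (f' r) w)) => //.
    move=> r; apply: cvgB; first by apply: cvgMr; exact: cp.
    by apply: (ip_cvg ipN); [exact: cf|exact: cvg_cst].
  move=> r /d[df dp le]; split.
    exact: (is_deriveB (is_deriveZ `|w| dp) (is_derive_ip w df)).
  rewrite subr_ge0 (le_trans (ip_cauchy_schwarz ipN _ _))// mulrC.
  by rewrite ler_wpM2l.
have : ip (f t) w - ip (f s) w = `|w| * `|w|.
  by rewrite -expr2 (normr_ip ipN) {2}/w !ipE.
by move=> E le; rewrite -(ler_pM2l nw) -E; lra.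
Qed.

End HilbertCalculus.

Section Antiderivative.
Context {R : realType} {H : completeNormedModType R}.
Variables (ip : {dot H for idfun}) (ipN : norm_induced_by ip).
Notation mu := (@lebesgue_measure R).

Lemma continuous_integrable (f : R -> R) a b : continuous f ->
  mu.-integrable `[a, b] (EFin \o f).
Proof.
move=> cf; apply: continuous_compact_integrable; first exact: segment_compact.
exact: continuous_subspaceT.
Qed.

(** The vector [G t] represents the functional that maps [w] to the integral of
    [ip (g s) w] over [[a, t]]. To see that [G] has the derivative [g t] in
    norm, the increment [w] of [G] minus its linear part is paired with
    itself. *)
Lemma exists_antiderivative (g : R -> H) (a : R) : continuous g ->
  exists G : R -> H, forall t : R, a < t -> is_derive t 1 G (g t).
Proof.
move=> cg.
have cgw w : continuous (fun s => ip (g s) w) by move=> s; apply: (continuous_ip ipN); exact: cg.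
have intg w t : mu.-integrable `[a, t] (EFin \o (fun s => ip (g s) w)).
  exact: continuous_integrable.
pose l t w : R := (\int[mu]_(s in `[a, t]) (ip (g s) w))%R.
have ex t : exists u, forall w, ip u w = l t w.
  apply: (riesz_representation ipN (K := (\int[mu]_(s in `[a, t]) `|g s|)%R)).
    move=> c v w.
    have cgc : continuous (fun s => c * ip (g s) v).
      by move=> s; apply: cvgMr; exact: cgw.
    rewrite /l -RintegralZl// -RintegralD//; last exact: continuous_integrable cgc.
    by apply: eq_Rintegral => s _; rewrite !ipE.
  move=> w; rewrite /l; apply: (le_trans (le_normr_Rintegral _ (intg w t))) => //.
  rewrite -RintegralZr//; last first.
    by apply: continuous_integrable => s; apply: cvg_norm; exact: cg.
  apply: le_Rintegral => //.
  - by apply: continuous_integrable => s; apply: cvg_norm; exact: cgw.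
  - apply: continuous_integrable => s; apply: cvgMl; apply: cvg_norm; exact: cg.
  - by move=> s _; exact: ip_norm_le.
have [G GP] := choice ex.
have dG w s : a < s -> is_derive s 1 (fun s => ip (G s) w) (ip (g s) w).
  move=> as_; rewrite (_ : (fun s => _) = (fun s => l s w)); last first.
    by apply/funext => r; rewrite GP.
  have [||d dE] := @continuous_FTC1_closed R (fun s => ip (g s) w) a s (s + 1) _ (intg w _) as_.
  - by rewrite ltrDl.
  - exact: cgw.
  - by apply: DeriveDef; [exact: d|rewrite -derive1E].
exists G => t at_; apply/is_derive_approxP => e e0.
have [d /= d0 hd] := (cvgrPdist_le _ _).1 (cg t) e e0.
have key u v : u <= v -> a < u -> `|t - u| < d -> `|t - v| < d ->
    `|G v - G u - (v - u) *: g t| <= e * (v - u).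
  move=> uv au tu tv; set w := G v - G u - _.
  have [->|w0] := eqVneq w 0; first by rewrite normr0 mulr_ge0 ?subr_ge0 ?(ltW e0).
  have nw : 0 < `|w| by rewrite normr_gt0.
  pose P (r : R) := e * `|w| * r - (ip (G r) w - r * ip (g t) w).
  have : P u <= P v.
    have dp (r : R) : a < r -> is_derive r 1 P
        (e * `|w| - (ip (g r) w - ip (g t) w)).
      move=> ar.
      have d1 : is_derive r 1 (fun r : R => e * `|w| * r) (e * `|w|).
        by apply: is_derive_eq; rewrite [_ *: _]mulr1.
      have d2 : is_derive r 1 (fun r : R => r * ip (g t) w) (ip (g t) w).
        by apply: is_derive_eq; rewrite scaler0 add0r [_ *: _]mulr1.
      exact: (is_deriveB d1 (is_deriveB (dG w r ar) d2)).
    apply: (@nonneg_derive_le _ P (fun r => e * `|w| - (ip (g r) w - ip (g t) w)) _ _ uv).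
      apply: continuous_within => r /=; rewrite in_itv/= => /andP[ur rv].
      by apply: is_derive_continuous (dp r _); exact: lt_le_trans ur.
    move=> r /andP[ur rv]; split; first by apply: dp; exact: lt_trans ur.
    rewrite -linearBl subr_ge0 (le_trans (ip_cauchy_schwarz ipN _ _))// ler_wpM2r//.
    rewrite distrC; apply: hd => /=.
    by move: tu tv; rewrite !ltr_norml => /andP[? ?] /andP[? ?]; apply/andP; split; lra.
  have ipw z : ip w z = ip (G v) z - ip (G u) z - (v - u) * ip (g t) z.
    by rewrite /w !ipE.
  have := ipw w; rewrite -(normr_ip ipN) expr2 => E le.
  rewrite -(ler_pM2l nw) E; move: le; rewrite /P; lra.
exists (Num.min d (t - a)); first by rewrite /= lt_min d0 subr_gt0.
move=> h /=; rewrite sub0r normrN lt_min => /andP[hd' hta].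
have tht : t - (h + t) = - h by ring.
have [h0|h0] := leP 0 h.
  rewrite (ger0_norm h0) in hd' hta *.
  have hE : h + t - t = h by rewrite addrK.
  rewrite -{2}hE -[in leRHS]hE; apply: key; rewrite ?subrr ?normr0//; first by rewrite lerDr.
  by rewrite tht normrN ger0_norm.
rewrite (ltr0_norm h0) in hd' hta *.
have -> : G (h + t) - G t - h *: g t = - (G t - G (h + t) - (t - (h + t)) *: g t).
  by rewrite tht scaleNr opprK opprD opprB.
rewrite normrN -tht; apply: key; rewrite ?subrr ?normr0//; [lra|lra|].
by rewrite tht normrN ltr0_norm.
Qed.

End Antiderivative.

Section OdeTools.
Context {R : realType} {H : completeNormedModType R}.
Variables (ip : {dot H for idfun}) (ipN : norm_induced_by ip).
Notation mu := (@lebesgue_measure R).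
Implicit Types (f g : R -> H) (a b s t : R).

Lemma is_derive_scale (k : R -> R) f t (k' : R) (l : H) :
  is_derive t 1 k k' -> is_derive t 1 f l ->
  is_derive t 1 (fun s => k s *: f s) (k' *: f t + k t *: l).
Proof.
move=> dk df; have ck := is_derive_continuous dk.
have cl : (h^-1 *: (k (h *: 1 + t) *: f (h *: 1 + t) - k t *: f t)) @[h --> 0^'] -->
    k' *: f t + k t *: l.
  have -> : (fun h : R => h^-1 *: (k (h *: 1 + t) *: f (h *: 1 + t) - k t *: f t)) =
     (fun h : R => (h^-1 * (k (h *: 1 + t) - k t)) *: f t +
        k (h *: 1 + t) *: (h^-1 *: (f (h *: 1 + t) - f t))).
    apply/funext => h; apply: (ip_ext ipN) => w; rewrite !ipE.
    ring.
  apply: cvgD; first apply: cvgZl.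
    by case: dk => [dk <-]; exact: dk.
  apply: cvgZ; last by case: df => [df <-]; exact: df.
  apply: cvg_within_filter.
  have ht : (h *: (1 : R) + t) @[h --> (0 : R)] --> t.
    rewrite -[X in _ --> X]add0r -[X in X + t](scale0r (1 : R)).
    by apply: cvgD; [apply: cvgZl; exact: cvg_id|exact: cvg_cst].
  exact: (cvg_comp _ _ ht ck).
by split; [apply/cvg_ex; eexists; exact: cl|exact/cvg_lim].
Qed.

(** This includes the endpoint [t = a], where the derivative relative to the
    half line is one-sided. *)
Lemma derive_on_half_line f a t (l : H) : a <= t -> is_derive t 1 f l ->
  derivable_on `[a, +oo[%classic f t /\ derive_on `[a, +oo[%classic f t = l.
Proof.
move=> at_ [df dfl].
have cl : (h^-1 *: (f (h + t) - f t))
    @[h --> within [set h | `[a, +oo[%classic (h + t)] 0^'] --> l.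
  apply: cvg_trans (_ : (h^-1 *: (f (h + t) - f t)) @[h --> 0^'] --> l).
    apply: cvg_app; exact: cvg_within.
  rewrite -dfl (_ : (fun h => _) = (fun h : R => h^-1 *: (f (h *: 1 + t) - f t))); first exact: df.
  by apply/funext => h; rewrite [h *: 1]mulr1.
have PF : ProperFilter (within [set h | `[a, +oo[%classic (h + t)] (0 : R)^').
  apply: Build_ProperFilter_ex => A [d /= d0 hd]; exists (d / 2).
  apply: hd => /=.
  - by rewrite sub0r normrN gtr0_norm ?divr_gt0// ltr_pdivrMr// ltr_pMr// ltr1n.
  - by rewrite gt_eqF// divr_gt0.
  - by rewrite in_itv/= andbT ler_wpDl// divr_ge0// ltW.
by split; [apply/cvg_ex; exists l|exact/cvg_lim].
Qed.

Lemma is_derive_of_derivable_on f a t : a < t -> derivable_on `[a, +oo[%classic f t ->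
  is_derive t 1 f (derive_on `[a, +oo[%classic f t).
Proof.
move=> at_; have nI : nbhs t `[a, +oo[%classic.
  have : \forall s \near t, a < s by exact: lt_nbhsr.
  by apply: filterS => s /ltW; rewrite /= in_itv/= andbT.
have [-> ->] := derive_on_interior f nI.
by move=> df; rewrite derive1E; exact: DeriveDef.
Qed.

End OdeTools.

(** * Absolutely continuous curves *)

Section AbsolutelyContinuous.
Context {R : realType} {H : normedModType R}.
Notation mu := (@lebesgue_measure R).
Implicit Types (f : R -> H) (a b s t : R).

Lemma abs_continuous_pairs a b f e d (l : seq (R * R)) :
  (forall (n : nat) (u v : 'I_n -> R),
      (forall i, a <= u i /\ u i <= v i /\ v i <= b) ->
      trivIset setT (fun i => `]u i, v i[%classic) ->
      \sum_(i < n) (v i - u i) < d ->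
      \sum_(i < n) `|f (v i) - f (u i)| < e) ->
  (forall p, p \in l -> [/\ a <= p.1, p.1 <= p.2 & p.2 <= b]) ->
  pairwise (fun p q : R * R => q.2 <= p.1) l ->
  \sum_(p <- l) (p.2 - p.1) < d -> \sum_(p <- l) `|f p.2 - f p.1| < e.
Proof.
move=> ac lab sep; rewrite !(big_nth (a, a)) !big_mkord; apply: ac.
  by move=> i; have [] := lab (nth (a, a) l i) (mem_nth _ (ltn_ord i)).
move=> i j _ _ [t [/=]]; rewrite !in_itv/= => /andP[it ti] /andP[jt tj].
have /(pairwiseP (a, a)) h := sep.
have [ij|ij|/val_inj//] := ltngtP i j.
  by have /(lt_le_trans tj)/lt_trans/(_ it) := h i j (ltn_ord i) (ltn_ord j) ij; rewrite ltxx.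
by have /(lt_le_trans ti)/lt_trans/(_ jt) := h j i (ltn_ord j) (ltn_ord i) ij; rewrite ltxx.
Qed.

(** Let [c] be the supremum of the points of [[a, b]] where [P] holds. The step
    property at [c] shows that [P] holds at [c], and also a little beyond unless
    [c = b]. *)
Lemma real_induction (P : R -> Prop) a b : a <= b -> P a ->
  (forall c, a <= c <= b -> exists2 d, 0 < d & forall s t, a <= s -> s <= c ->
     c <= t -> t <= b -> c - d < s -> t < c + d -> P s -> P t) -> P b.
Proof.
move=> ab Pa step; pose T := [set t | a <= t <= b /\ P t].
have Ta : T a by rewrite /T /= lexx ab.
have supT : has_sup T by split; [exists a|exists b => t [/andP[]]].
pose c := sup T.
have ac : a <= c by apply: (sup_ubound supT.2).
have cb : c <= b by apply: ge_sup => [|t [/andP[]]//]; exists a.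
have [|d d0 hd] := step c; first by rewrite ac.
have [s [/andP[as_ sb] Ps] cs] := sup_adherent d0 supT.
have sc : s <= c by apply: (sup_ubound supT.2); split => //; rewrite as_.
have ht t : c <= t -> t <= b -> t < c + d -> P t.
  by move=> ct tb tcd; apply: (hd s t).
have [cltb|bc] := ltP c b; last first.
  by apply: ht => //; apply: (le_lt_trans bc); rewrite ltrDl.
pose t := Num.min b (c + d / 2).
have ct : c < t by rewrite lt_min cltb ltrDl divr_gt0.
have tb : t <= b by rewrite ge_min lexx.
have Pt : P t.
  by apply: ht => //; [exact: ltW|rewrite gt_min ltrD2l ltr_pdivrMr// ltr_pMr// ltr1n orbT].
have : t <= c by apply: (sup_ubound supT.2); split => //; rewrite tb andbT (le_trans ac)// ltW.
by rewrite leNgt ct.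
Qed.

Lemma negligible_open_cover (N : set R) d : mu.-negligible N -> 0 < d ->
  exists U : set R, [/\ open U, N `<=` U & (mu U < d%:E)%E].
Proof.
move=> [N' [mN' N'0 NN']] d0.
have [|U [oU N'U UN']] := lebesgue_regularity_outer mN' _ d0.
  by rewrite [ltLHS]N'0 ltry.
exists U; split => //; first exact: subset_trans N'U.
rewrite -(setDKU N'U); apply: (le_lt_trans (outer_measureU2 mu _ _)).
by rewrite [X in (_ + X)%E]N'0 adde0.
Qed.

(** The points where the derivative fails to vanish are covered by an open set
    [U] of small measure. Moving from [a] to [b] by real induction, [f] grows at
    a rate of at most [e] near the points outside [U], while the steps made
    inside [U] are recorded in the list [l]. These steps are disjoint and of
    small total length, so by absolute continuity [f] varies little over
    them. *)
Lemma abs_continuous_derive0 f a b : a <= b -> abs_continuous a b f ->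
  mu.-negligible [set t | a < t < b /\ ~ is_derive t 1 f 0] -> f b = f a.
Proof.
move=> ab acf negl; apply/eqP; rewrite -subr_eq0 -normr_le0.
apply/ler_addgt0Pr => e0 e00; rewrite add0r.
(* [e * (b - a) + e = e0]: growth outside [U] plus variation inside [U]. *)
pose e := e0 / (b - a + 1).
have ba1 : 0 < b - a + 1 by rewrite ltr_wpDl// subr_ge0.
have e_gt0 : 0 < e by rewrite divr_gt0.
have [d d0 acd] := acf e e_gt0.
(* The endpoints carry no derivative; being two points, they join the bad set. *)
pose N := [set t | a < t < b /\ ~ is_derive t 1 f 0] `|` [set a] `|` [set b].
have nN : mu.-negligible N.
  apply: negligibleU; first apply: negligibleU => //.
    by apply/negligibleP => //; exact: lebesgue_measure_set1.
  by apply/negligibleP => //; exact: lebesgue_measure_set1.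
have [U [oU NU muU]] := negligible_open_cover nN d0.
pose P t := exists l : seq (R * R), [/\
  forall p, p \in l -> [/\ a <= p.1, p.1 <= p.2 & p.2 <= t],
  pairwise (fun p q : R * R => q.2 <= p.1) l,
  ((\sum_(p <- l) (p.2 - p.1))%:E <= mu (U `&` `]a, t[))%E &
  `|f t - f a| <= e * (t - a) + \sum_(p <- l) `|f p.2 - f p.1| ].
have mUt t : measurable (U `&` `]a, t[) by apply: measurableI => //; exact: open_measurable.
have Pb : P b.
  apply: (real_induction ab).
    exists [::]; split => //; first by rewrite big_nil.
    by rewrite !subrr normr0 mulr0 big_nil addr0.
  move=> c /andP[ac cb]; have [Uc|nUc] := pselect (U c).
    have [d1 /= d10 hd1] := (nbhs_ballP _ _).1 (open_nbhs_nbhs (conj oU Uc)).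
    exists d1 => // s t as_ sc ct tb cs tc [l [lP lsep lU lf]].
    have stU : `]s, t[ `<=` U.
      move=> r; rewrite /= in_itv/= => /andP[sr rt]; apply: hd1.
      by rewrite /ball/= ltr_norml; apply/andP; split; lra.
    exists ((s, t) :: l); split.
    - move=> p; rewrite inE => /predU1P[->|/lP[? ? ?]] /=.
        by split => //; exact: le_trans ct.
      by split => //; lra.
    - by rewrite /= lsep andbT; apply/allP => p /lP[].
    - rewrite big_cons EFinD /=.
      have -> : (t - s)%:E = mu `]s, t[.
        rewrite lebesgue_measure_itv/= lte_fin; case: ltP => // ts.
        by congr (_%:E); lra.
      apply: (@le_trans _ _ (mu (`]s, t[ `|` (U `&` `]a, s[)))%E).
        have dis : `]s, t[ `&` (U `&` `]a, s[) = set0.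
          rewrite -subset0 => r [/=]; rewrite !in_itv/= => /andP[? ?] [_] /andP[? ?].
          by lra.
        have -> : (mu (`]s, t[ `|` (U `&` `]a, s[)) = mu `]s, t[ + mu (U `&` `]a, s[))%E.
          by apply: measureU => //; exact: mUt.
        exact: leeD.
      apply: le_measure; [|exact: (mem_set (mUt _))|].
        by apply/mem_set/measurableU => //; exact: mUt.
      move=> r [rst|[Ur]].
        split; first exact: stU.
        move: rst; rewrite /= !in_itv/= => /andP[? ?].
        by apply/andP; split; lra.
      rewrite /= !in_itv/= => /andP[? ?]; split => //.
      by apply/andP; split; lra.
    - rewrite big_cons /=.
      have := ler_distD (f s) (f t) (f a).
      have : e * (s - a) <= e * (t - a) by rewrite ler_pM2l//; lra.
      by lra.
  have acb : a < c < b.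
    rewrite !lt_neqAle ac cb !andbT; apply/andP; split; apply/negP => /eqP E; apply: nUc; apply: NU.
      by left; right.
    by right.
  have /is_derive_approxP/(_ e e_gt0)[d1 /= d10 hd1] : is_derive c 1 f 0.
    by apply: contrapT => nd; apply: nUc; apply: NU; left; left.
  have hc r : `|r - c| < d1 -> `|f r - f c| <= e * `|r - c|.
    move=> rc; have := hd1 (r - c); rewrite /= sub0r normrN => /(_ rc).
    by rewrite subrK scaler0 subr0.
  exists d1 => // s t as_ sc ct tb cs tc [l [lP lsep lU lf]].
  exists l; split => //.
  - by move=> p /lP[? ? ?]; split => //; lra.
  - apply: (le_trans lU); apply: le_measure; [exact: (mem_set (mUt _))|exact: (mem_set (mUt _))|].
    by move=> r [Ur]; rewrite /= !in_itv/= => /andP[? ?]; split => //=; apply/andP; split; lra.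
  - have := hc s; have := hc t; rewrite (distrC s) !ger0_norm ?subr_ge0//.
    rewrite (distrC (f s)) => /(_ _)h1 /(_ _)h2.
    have := ler_distD (f s) (f t) (f a); have := ler_distD (f c) (f t) (f s).
    have sc' : c - s < d1 by lra.
    have tc' : t - c < d1 by lra.
    by have := h1 tc'; have := h2 sc'; lra.
have [l [lP lsep lU lf]] := Pb.
have : \sum_(p <- l) `|f p.2 - f p.1| < e.
  apply: (abs_continuous_pairs acd) => //.
  rewrite -lte_fin; apply: (le_lt_trans lU); apply: le_lt_trans muU.
  apply: le_measure; [exact: (mem_set (mUt _))| |by move=> ? []].
  by apply/mem_set; exact: open_measurable.
move=> h; apply: (le_trans lf).
have -> : e0 = e * (b - a) + e by rewrite /e; field; rewrite gt_eqF.
by lra.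
Qed.

End AbsolutelyContinuous.

Section AbsContinuousTools.
Context {R : realType} {H : normedModType R}.
Notation mu := (@lebesgue_measure R).
Implicit Types (f g k : R -> H) (a b s t : R).

Lemma max_lipschitz a s t : `|Num.max s a - Num.max t a| <= `|s - t|.
Proof.
case: (leP s a) => sa; case: (leP t a) => ta; rewrite ?subrr ?normr0//.
- by rewrite !ltr0_norm ?subr_lt0//; lra.
- by rewrite !gtr0_norm ?subr_gt0//; lra.
Qed.

Lemma min_lipschitz a s t : `|Num.min s a - Num.min t a| <= `|s - t|.
Proof.
case: (leP s a) => sa; case: (leP t a) => ta; rewrite ?subrr ?normr0//.
- by rewrite !ler0_norm ?subr_le0//; lra.
- by rewrite !ger0_norm ?subr_ge0//; lra.
Qed.

Lemma lipschitz_abs_continuous f a b K :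
  (forall u v, a <= u -> u <= v -> v <= b -> `|f v - f u| <= K * (v - u)) ->
  abs_continuous a b f.
Proof.
move=> fK e e0; have K1 : 0 < `|K| + 1 by rewrite ltr_wpDl.
exists (e / (`|K| + 1)); first by rewrite divr_gt0.
move=> n u v uv _; rewrite ltr_pdivlMr// => h; apply: le_lt_trans h.
rewrite mulr_suml; apply: ler_sum => i _; have [aui [uvi vib]] := uv i.
apply: (le_trans (fK _ _ aui uvi vib)); rewrite mulrC ler_wpM2l ?subr_ge0//.
by rewrite (le_trans (ler_norm _))// lerDl.
Qed.

Lemma abs_continuous_dominated f g k a b K : 0 <= K ->
  abs_continuous a b g -> abs_continuous a b k ->
  (forall u v, a <= u -> u <= v -> v <= b ->
     `|f v - f u| <= K * (`|g v - g u| + `|k v - k u| + (v - u))) ->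
  abs_continuous a b f.
Proof.
move=> K0 acg ack fgk e e0; have K1 : 0 < 3 * (K + 1) by rewrite mulr_gt0// ltr_wpDl.
have eK : 0 < e / (3 * (K + 1)) by rewrite divr_gt0.
have [d1 d10 h1] := acg _ eK; have [d2 d20 h2] := ack _ eK.
exists (Num.min (Num.min d1 d2) (e / (3 * (K + 1)))); first by rewrite !lt_min d10 d20.
move=> n u v uv tuv; rewrite !lt_min => /andP[/andP[]].
move=> /(h1 _ _ _ uv tuv) {}h1 /(h2 _ _ _ uv tuv) {}h2 h3.
move: h1 h2 h3; rewrite !ltr_pdivlMr//.
set S1 := (\sum_(i < n) `|g _ - _|); set S2 := (\sum_(i < n) `|k _ - _|).
set S3 := (\sum_(i < n) (v i - u i)) => h1 h2 h3.
apply: (@le_lt_trans _ _ (K * (S1 + S2 + S3))).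
  rewrite -!big_split mulr_sumr.
  by apply: ler_sum => i _; have [aui [uvi vib]] := uv i; exact: fgk.
have S10 : 0 <= S1 by apply: sumr_ge0.
have S20 : 0 <= S2 by apply: sumr_ge0.
have S30 : 0 <= S3 by apply: sumr_ge0 => i _; rewrite subr_ge0; case: (uv i) => _ [].
nra.
Qed.

Lemma abs_continuous_modulus f a b : abs_continuous a b f ->
  forall e, 0 < e -> exists2 d, 0 < d & forall u v, a <= u -> u <= v -> v <= b ->
    v - u < d -> `|f v - f u| < e.
Proof.
move=> acf e /acf[d d0 hd]; exists d => // u v au uv vb vud.
have := hd 1%N (fun=> u) (fun=> v) (fun=> conj au (conj uv vb)).
rewrite !big_ord1; apply => //.
by move=> i j _ _ _; rewrite !ord1.
Qed.

Lemma locally_abs_continuous_clamp f a : locally_abs_continuous a f ->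
  continuous (fun t => f (Num.max t a)).
Proof.
move=> acf t; apply/cvgrPdist_le => e e0.
have am s : a <= Num.max s a by rewrite le_max lexx orbT.
have [|d d0 hd] := abs_continuous_modulus (acf (Num.max t a + 1) _) e0.
  by rewrite ler_wpDr.
exists (Num.min d 1) => /=; first by rewrite lt_min d0 ltr01.
move=> s /=; rewrite lt_min => /andP[sd s1].
have h := max_lipschitz a t s; apply/ltW.
have [ts|st] := leP (Num.max t a) (Num.max s a).
  rewrite distrC; apply: hd => //.
    by move: h; rewrite ler0_norm ?subr_le0//; lra.
  by move: h; rewrite ler0_norm ?subr_le0//; lra.
apply: hd => //; [exact: ltW|by rewrite lerDl|].
by move: h; rewrite gtr0_norm ?subr_gt0//; lra.
Qed.

(** A nonempty open interval has positive measure. *)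
Lemma negligible_dense (N : set R) a b : mu.-negligible N -> a < b ->
  exists2 s, a < s < b & ~ N s.
Proof.
move=> nN ab; apply: contrapT => h.
have : mu.-negligible `]a, b[%classic.
  apply: negligibleS nN => s; rewrite /= in_itv/= => sab.
  by apply: contrapT => nNs; apply: h; exists s.
move=> /negligibleP; rewrite /= lebesgue_measure_itv/= lte_fin ab => /(_ _)/eqP.
by rewrite -EFinB eqe subr_eq0 gt_eqF// => /(_ (measurable_itv _)).
Qed.

(** The difference quotients of [g] at [t] are limits of those of [f], because
    [g] is continuous and the points where [f] and [g] agree are dense. *)
Lemma is_derive_ae_eq f g (N : set R) a t (l : H) : mu.-negligible N -> a < t ->
  (forall s, a < s -> ~ N s -> f s = g s) -> f t = g t ->
  (forall s, a < s -> {for s, continuous g}) ->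
  is_derive t 1 f l -> is_derive t 1 g l.
Proof.
move=> nN at_ fg fgt cg /is_derive_approxP df; apply/is_derive_approxP => e e0.
have [d /= d0 hd] := df e e0.
exists (Num.min d (t - a)) => /=; first by rewrite lt_min d0 subr_gt0.
move=> h; rewrite /= sub0r normrN lt_min => /andP[hd' hta].
rewrite leNgt; apply/negP => hgt.
pose D (s : R) := `|g s - g t - (s - t) *: l| - e * `|s - t|.
have cD : {for h + t, continuous D}.
  have aht : a < h + t by move: hta; rewrite ltr_norml => /andP[]; lra.
  have cid : {for h + t, continuous (fun s : R => s - t)}.
    by apply: cvgB; [exact: cvg_id|exact: cvg_cst].
  apply: cvgB; last by apply: cvgMr; apply: cvg_norm; exact: cid.
  apply: cvg_norm; apply: cvgB; last by apply: cvgZl; exact: cid.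
  by apply: cvgB; [exact: cg|exact: cvg_cst].
have D0 : 0 < D (h + t) by rewrite /D addrK subr_gt0.
have : \forall s \near h + t, 0 < D s by exact: (cvgr_gt _ cD).
move=> [r /= r0 hr].
pose q := Num.min r (Num.min d (t - a) - `|h|).
have q0 : 0 < q by rewrite lt_min r0 subr_gt0 lt_min hd'.
have [s /andP[s1 s2] nNs] := @negligible_dense N (h + t - q) (h + t + q) nN ltac:(lra).
have qr : q <= r by rewrite ge_min lexx.
have qd : q <= d - `|h|.
  by rewrite ge_min lerD2r ge_min lexx orbT.
have qa : q <= t - a - `|h|.
  by rewrite ge_min lerD2r ge_min lexx !orbT.
have /andP[hb1 hb2] : - `|h| <= h <= `|h| by rewrite -ler_norml.
have Ds : 0 < D s.
  by apply: hr => /=; rewrite ltr_norml; apply/andP; split; lra.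
have as_ : a < s by lra.
have := hd (s - t); rewrite /= sub0r normrN subrK => hds.
have : `|f s - f t - (s - t) *: l| <= e * `|s - t|.
  by apply: hds; rewrite ltr_norml; apply/andP; split; lra.
by rewrite fg// fgt => le; move: Ds; rewrite /D subr_gt0 ltNge le.
Qed.

End AbsContinuousTools.

(** * Weighted contractions on curves *)

Section WeightedFixpoint.
Context {R : realType} {H : completeNormedModType R}.
Variables (T : (R -> H) -> R -> H) (t0 k : R).
Hypothesis k0 : 0 <= k.

Let weight s := expR (k * (s - t0)).

(** [T] is a contraction for the norm [sup |x s| * expR (- k (s - t0))]. The
    bound is asked on every [[t0, b]] separately: this expresses that [T] is of
    Volterra type, and spares any growth condition at infinity. *)
Definition weighted_halving := forall x y b C, continuous x -> continuous y ->
  (forall s, t0 <= s <= b -> `|x s - y s| <= C * expR (k * (s - t0))) ->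
  forall s, t0 <= s <= b -> `|T x s - T y s| <= C / 2 * expR (k * (s - t0)).

Hypothesis T_continuous : forall x, continuous x -> continuous (T x).
Hypothesis T_halving : weighted_halving.

Let weight_ge1 s : t0 <= s -> 1 <= weight s.
Proof. by move=> ts; rewrite -expR0 ler_expR mulr_ge0// subr_ge0. Qed.

Lemma eventually_half_pow (C e : R) : 0 < e -> exists N, forall n, (N <= n)%N -> C / 2 ^+ n <= e.
Proof.
move=> e0.
have : (geometric C (2^-1) : R ^nat) @ \oo --> (0 : R).
  by apply: cvg_geometric; rewrite ger0_norm// invf_lt1// ltr1n.
move=> /cvgrPdist_le/(_ e e0)[N _ hN]; exists N => n Nn.
have := hN n Nn; rewrite /= sub0r normrN exprVn; apply: le_trans; exact: ler_norm.
Qed.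

Lemma continuous_bounded (x : R -> H) a b : continuous x ->
  exists2 C, 0 <= C & forall s, a <= s <= b -> `|x s| <= C.
Proof.
move=> cx; have [ab|ba] := leP a b; last first.
  by exists 0 => // s; lra.
have [|c cab hc] := @EVT_max R (fun s => `|x s|) a b ab.
  by apply: continuous_subspaceT => s; apply: cvg_norm; exact: cx.
by exists `|x c| => // s sab; apply: hc; rewrite in_itv/=.
Qed.

Let bound_weight (x : R -> H) C b : (forall s, t0 <= s <= b -> `|x s| <= C) ->
  forall s, t0 <= s <= b -> `|x s| <= C * weight s.
Proof.
move=> h s sb; apply: (le_trans (h s sb)); rewrite ler_peMr ?weight_ge1//.
  by apply: le_trans (h s sb).
by case/andP: sb.
Qed.

(** On [[t0, b]] the distance of two fixed points is finite by compactness, and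
    [T] halves it indefinitely. *)
Lemma weighted_fixpoint_unique x y : continuous x -> continuous y ->
  (forall s, t0 <= s -> T x s = x s) -> (forall s, t0 <= s -> T y s = y s) ->
  forall s, t0 <= s -> x s = y s.
Proof.
move=> cx cy Tx Ty b t0b.
have [C C0 hC] := @continuous_bounded (fun s => x s - y s) t0 b (fun s => cvgB (cx s) (cy s)).
have hn n s : t0 <= s <= b -> `|x s - y s| <= C / 2 ^+ n * weight s.
  elim: n s => [|n IH] s sb.
    by rewrite expr0 divr1; exact: (bound_weight hC).
  have [t0s _] := andP sb; rewrite -Tx// -Ty//.
  by rewrite exprSr invfM mulrA; exact: T_halving IH _ sb.
apply/eqP; rewrite -subr_eq0 -normr_le0; apply/ler_addgt0Pr => e e0; rewrite add0r.
have [N hN] := eventually_half_pow (C * weight b) e0.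
have := hn N b; rewrite t0b lexx mulrAC => /(_ isT)/le_trans; apply.
exact: hN.
Qed.

(** The iterates of [T] converge uniformly on every [[t0, b]]; the limit is
    extended to the left of [t0] by its value at [t0]. *)
Lemma weighted_fixpoint_exists :
  exists2 x, continuous x & forall s, t0 <= s -> T x s = x s.
Proof.
pose x n := iter n T (fun=> 0).
have cx n : continuous (x n).
  by elim: n => [|n IH] /=; [exact: cst_continuous|exact: T_continuous].
have step b : exists2 C, 0 <= C & forall n s, t0 <= s <= b ->
    `|x n.+1 s - x n s| <= C / 2 ^+ n * weight s.
  have [C C0 hC] := @continuous_bounded (fun s => x 1 s - x 0 s) t0 b
    (fun s => cvgB (cx 1 s) (cx 0 s)).
  exists C => //; elim=> [|n IH] s sb.
    by rewrite expr0 divr1; exact: (bound_weight hC).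
  by rewrite exprSr invfM mulrA; exact: T_halving IH _ sb.
have cauchy b : exists2 C, 0 <= C & forall n m s, t0 <= s <= b ->
    `|x (n + m)%N s - x n s| <= C / 2 ^+ n.
  have [C C0 hC] := step b; exists (2 * C * weight b).
    by rewrite !mulr_ge0// expR_ge0.
  move=> n m s sb.
  suff : `|x (n + m)%N s - x n s| <=
      (2 * C * weight b) / 2 ^+ n - (2 * C * weight b) / 2 ^+ (n + m).
    move=> /le_trans; apply; rewrite gerBl divr_ge0// ?exprn_ge0//.
    by rewrite !mulr_ge0// expR_ge0.
  elim: m => [|m IH]; first by rewrite addn0 !subrr normr0.
  rewrite addnS; have := ler_distD (x (n + m)%N s) (x (n + m).+1 s) (x n s).
  have := hC (n + m)%N s sb.
  have : C / 2 ^+ (n + m) * weight s <= C / 2 ^+ (n + m) * weight b.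
    rewrite ler_wpM2l ?divr_ge0 ?exprn_ge0// ler_expR ler_wpM2l//.
    by case/andP: sb => _ sb; lra.
  have -> : 2 * C * weight b / 2 ^+ (n + m).+1 = C / 2 ^+ (n + m) * weight b.
    by rewrite exprS; field; rewrite expf_neq0.
  have -> : C / 2 ^+ (n + m) * weight b = (2 * C * weight b / 2 ^+ (n + m)) / 2.
    by field; rewrite expf_neq0.
  by lra.
pose y s := limn (x ^~ s).
have cvgx s : t0 <= s -> x ^~ s @ \oo --> y s.
  move=> t0s; apply: cvg_near_constant => e e0.
  have [C C0 hC] := cauchy s; have [N hN] := eventually_half_pow C e0.
  exists (x N s); exists N => // n /= Nn.
  rewrite -(subnKC Nn); apply: le_trans (hN N (leqnn N)).
  by apply: hC; rewrite t0s lexx.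
have dist b : exists2 C, 0 <= C & forall n s, t0 <= s <= b -> `|y s - x n s| <= C / 2 ^+ n.
  have [C C0 hC] := cauchy b; exists C => // n s sb.
  have cd : (fun m => `|x m s - x n s|) @ \oo --> `|y s - x n s|.
    by apply: cvg_norm; apply: cvgB; [apply: cvgx; case/andP: sb|exact: cvg_cst].
  apply: (cvgr_to_le cd); exists n => // m /= nm.
  by rewrite -(subnKC nm); exact: hC.
pose z s := y (Num.max s t0).
have cz : continuous z.
  move=> t; apply/cvgrPdist_le => e e0.
  have e30 : 0 < e / 3 by rewrite divr_gt0.
  have [C C0 hC] := dist (Num.max t t0 + 1).
  have [N /(_ N (leqnn N)) hN] := eventually_half_pow C e30.
  have cm : {for t, continuous (fun s : R => Num.max s t0)}.
    by apply: continuous_max; [exact: cvg_id|exact: cvg_cst].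
  have cN : {for t, continuous (fun s => x N (Num.max s t0))}.
    by apply: (continuous_comp cm); exact: cx.
  near=> r.
  have tb : t0 <= Num.max t t0 <= Num.max t t0 + 1 by rewrite le_max lexx orbT lerDl ler01.
  have rb : t0 <= Num.max r t0 <= Num.max t t0 + 1.
    rewrite le_max lexx orbT ge_max /=; apply/andP; split.
      by apply/ltW; near: r; apply: lt_nbhsl; rewrite ltr_pwDr// le_max lexx.
    by rewrite ler_wpDr// le_max lexx orbT.
  have h1 := le_trans (hC N _ tb) hN; have := le_trans (hC N _ rb) hN; rewrite distrC => h2.
  have h3 : `|x N (Num.max t t0) - x N (Num.max r t0)| <= e / 3.
    by near: r; exact: (cvgrPdist_le _ _).1 cN _ e30.
  have := ler_distD (x N (Num.max t t0)) (z t) (z r).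
  have := ler_distD (x N (Num.max r t0)) (x N (Num.max t t0)) (z r).
  by move: h1 h2 h3; rewrite /z; lra.
exists z => // s t0s.
have zE r : t0 <= r -> z r = y r by move=> ?; rewrite /z max_l.
have [C C0 hC] := dist s.
apply/eqP; rewrite -subr_eq0 -normr_le0; apply/ler_addgt0Pr => e e0; rewrite add0r.
have [N hN] := eventually_half_pow (C * weight s) e0.
have sb : t0 <= s <= s by rewrite t0s lexx.
have hz r : t0 <= r <= s -> `|z r - x N r| <= C / 2 ^+ N * weight r.
  move=> rs; rewrite zE; last by case/andP: rs.
  by apply: (bound_weight (x := fun r => y r - x N r)) rs => q; exact: hC.
set A := C / 2 ^+ N * weight s.
have h1 : `|T z s - x N.+1 s| <= A / 2.
  by apply: (le_trans (T_halving cz (cx N) hz sb)); rewrite mulrAC.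
have h2 : `|z s - x N.+1 s| <= A / 2.
  rewrite zE//; apply: (le_trans (hC N.+1 s sb)).
  rewrite exprSr invfM mulrA ler_wpM2r// /A ler_peMr ?weight_ge1//.
  by rewrite divr_ge0// exprn_ge0.
have h3 : A <= e by rewrite /A mulrAC; exact: hN.
have := ler_distD (x N.+1 s) (T z s) (z s); rewrite (distrC (x N.+1 s) (z s)).
by move: h1 h2 h3; lra.
Unshelve. all: by end_near. Qed.

End WeightedFixpoint.

(** * The integral equation *)

Section IntegralOperator.
Context {R : realType} {H : completeNormedModType R}.
Variables (ip : {dot H for idfun}) (ipN : norm_induced_by ip).
Variables (M : H -> H) (L : R) (alpha beta t0 : R) (x0 c : H).
Hypotheses (ML : forall y z, `|M y - M z| <= L * `|y - z|) (t0_gt0 : 0 < t0).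
Implicit Types (x y g : R -> H) (s t b : R).

(** A single choice of primitives, so that integration from [t0] becomes an
    operator on curves. Starting the integrals at [t0 - 1] makes the derivative
    at [t0] two-sided. *)
Lemma exists_primitive : exists P : (R -> H) -> R -> H, forall g, continuous g ->
  P g t0 = 0 /\ forall t, t0 <= t -> is_derive t 1 (P g) (g t).
Proof.
suff ex g : exists G : R -> H, continuous g ->
    G t0 = 0 /\ forall t, t0 <= t -> is_derive t 1 G (g t).
  by have [P hP] := choice ex; exists P.
have [cg|ncg] := pselect (continuous g); last by exists (fun=> 0).
have [G dG] := exists_antiderivative ipN (t0 - 1) cg.
exists (fun t => G t - G t0) => _; split; first by rewrite subrr.
move=> t tt; have dGt : is_derive t 1 G (g t) by apply: dG; lra.
by have := is_deriveB dGt (is_derive_cst (G t0) t 1); rewrite subr0.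
Qed.

Variable P : (R -> H) -> R -> H.
Hypothesis P_primitive : forall g, continuous g ->
  P g t0 = 0 /\ forall t, t0 <= t -> is_derive t 1 (P g) (g t).

(* Time is stopped below [t0], where the coefficients would blow up; all curves
   below are thereby continuous on the whole line. *)
Let pos t := Num.max t t0.

Let pos_ge t : t0 <= pos t. Proof. by rewrite le_max lexx orbT. Qed.
Let pos_gt0 t : 0 < pos t. Proof. exact: lt_le_trans (pos_ge t). Qed.
Let posE t : t0 <= t -> pos t = t. Proof. exact: max_l. Qed.

Let pos_continuous : continuous pos.
Proof. by move=> t; apply: continuous_max; [exact: cvg_id|exact: cvg_cst]. Qed.

(** For a solution [x], [momentum x] is [x' + M x + (alpha / t) x], with
    derivative [- memory x], and [velocity x] is [x'] recovered from it. *)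
Definition memory x s := (alpha / pos s ^+ 2) *: x s + (beta / pos s) *: M (x s).
Definition momentum x t := c - P (memory x) (pos t).
Definition velocity x t := momentum x t - M (x t) - (alpha / pos t) *: x t.
Definition picard x t := x0 + P (velocity x) (pos t).

Lemma lipschitz_continuous : continuous M.
Proof.
move=> y; apply/cvgrPdist_le => e e0; have L1 : 0 < `|L| + 1 by rewrite ltr_wpDl.
have d0 : 0 < e / (`|L| + 1) by rewrite divr_gt0.
apply: filterS (nbhsx_ballx y _ d0) => z; rewrite -ball_normE /=.
rewrite ltr_pdivlMr// => /ltW h; apply: (le_trans (ML y z)).
apply: le_trans h; rewrite mulrC ler_wpM2l//.
by rewrite (le_trans (ler_norm _))// lerDl.
Qed.

Let M_comp_continuous x : continuous x -> continuous (fun s => M (x s)).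
Proof. by move=> cx s; apply: (continuous_comp (cx s)); exact: lipschitz_continuous. Qed.

Let coef_continuous k : continuous (fun s => k / pos s).
Proof.
move=> s; apply: cvgMr; apply: cvgV; first by rewrite gt_eqF.
exact: pos_continuous.
Qed.

Lemma memory_continuous x : continuous x -> continuous (memory x).
Proof.
move=> cx s; apply: cvgD; last first.
  by apply: cvgZ; [exact: coef_continuous|exact: M_comp_continuous].
apply: cvgZ; last exact: cx.
apply: cvgMr; apply: cvgV; first by rewrite expf_neq0// gt_eqF.
by rewrite expr2; apply: cvgM; exact: pos_continuous.
Qed.

Lemma primitive_clamp_continuous g : continuous g ->
  continuous (fun t => P g (pos t)).
Proof.
move=> cg t; have [_ dP] := P_primitive cg.
exact: (continuous_comp (pos_continuous (x:=t)) (is_derive_continuous (dP _ (pos_ge t)))).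
Qed.

Lemma momentum_continuous x : continuous x -> continuous (momentum x).
Proof.
move=> cx t; apply: cvgB; first exact: cvg_cst.
exact: (primitive_clamp_continuous (memory_continuous cx)).
Qed.

Lemma velocity_continuous x : continuous x -> continuous (velocity x).
Proof.
move=> cx t; apply: cvgB; last first.
  by apply: cvgZ; [exact: coef_continuous|exact: cx].
by apply: cvgB; [exact: momentum_continuous|exact: M_comp_continuous].
Qed.

Lemma picard_continuous x : continuous x -> continuous (picard x).
Proof.
move=> cx t; apply: cvgD; first exact: cvg_cst.
exact: (primitive_clamp_continuous (velocity_continuous cx)).
Qed.

Lemma primitive_continuous_on g b : continuous g ->
  {within `[t0, b], continuous (P g)}.
Proof.
move=> cg; apply: continuous_within => s; rewrite /= in_itv/= => /andP[ts _].
exact: is_derive_continuous ((P_primitive cg).2 s ts).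
Qed.

(** Integrating the weight gains the factor [1 / k]. *)
Lemma primitive_weighted_le g1 g2 b C k : 0 < k -> 0 <= C ->
  continuous g1 -> continuous g2 ->
  (forall s, t0 <= s <= b -> `|g1 s - g2 s| <= C * k * expR (k * (s - t0))) ->
  forall s, t0 <= s <= b -> `|P g1 s - P g2 s| <= C * expR (k * (s - t0)).
Proof.
move=> k0 C0 cg1 cg2 g12 s /andP[ts sb].
have [P10 dP1] := P_primitive cg1; have [P20 dP2] := P_primitive cg2.
pose w (r : R) := C * expR (k * (r - t0)).
have dw (r : R) : is_derive r 1 w (C * k * expR (k * (r - t0))).
  have dl : is_derive r 1 (fun r : R => k * (r - t0)) k.
    by apply: is_derive_eq; rewrite subr0 [_ *: _]mulr1.
  apply: is_derive_eq.
  by rewrite /= [_ *: _]mulrC; ring.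
have cw : {within `[t0, s], continuous w}.
  by apply: continuous_subspaceT => r; exact: is_derive_continuous (dw r).
have cP : {within `[t0, s], continuous (fun r => P g1 r - P g2 r)}.
  by move=> r; apply: cvgB; exact: primitive_continuous_on.
have := mean_value_inequality ipN ts cP cw.
move=> /(_ (fun r => g1 r - g2 r) (fun r => C * k * expR (k * (r - t0)))).
rewrite P10 P20 subrr subr0 => h; apply: (le_trans (h _)).
  move=> r /andP[tr rs]; split => //.
    exact: (is_deriveB (dP1 r (ltW tr)) (dP2 r (ltW tr))).
  by apply: g12; apply/andP; split; lra.
by rewrite gerBl /w mulr_ge0// expR_ge0.
Qed.

Lemma primitive_lipschitz g b : continuous g -> exists2 K, 0 <= K &
  forall u v, t0 <= u -> u <= v -> v <= b -> `|P g v - P g u| <= K * (v - u).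
Proof.
move=> cg; have [K K0 hK] := continuous_bounded t0 b cg; exists K => // u v tu uv vb.
have [_ dP] := P_primitive cg.
have dl (r : R) : is_derive r 1 (fun r : R => K * r) K.
  by apply: is_derive_eq; rewrite [_ *: _]mulr1.
rewrite mulrBr.
apply: (mean_value_inequality ipN (f' := g) (p := fun r => K * r) (p' := fun=> K) uv).
- apply: continuous_within => s; rewrite /= in_itv/= => /andP[us _].
  by apply: is_derive_continuous (dP s _); lra.
- by apply: continuous_subspaceT => r; exact: is_derive_continuous (dl r).
- move=> r /andP[ur rv]; split => //; first by apply: dP; lra.
  by apply: hK; apply/andP; split; lra.
Qed.

Let L_ge0 : exists2 L', 0 <= L' & forall y z : H, `|M y - M z| <= L' * `|y - z|.
Proof.
exists `|L| => // y z; apply: (le_trans (ML y z)).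
by rewrite ler_wpM2r// ler_norm.
Qed.

(** [K1] and [K2] are Lipschitz constants of [memory] and of the part of
    [velocity] without memory. The first integration does not increase weighted
    distances, as [1 <= k]; the second divides them by [k], and
    [K1 + K2 <= k / 2]. *)
Lemma picard_halving : exists2 k, 0 <= k & weighted_halving picard t0 k.
Proof.
have [L' L'0 ML'] := L_ge0.
pose K1 := `|alpha| / t0 ^+ 2 + `|beta| / t0 * L'.
pose K2 := L' + `|alpha| / t0.
have t0_ge0 := ltW t0_gt0.
have K10 : 0 <= K1 by rewrite addr_ge0 ?mulr_ge0 ?invr_ge0 ?exprn_ge0.
have K20 : 0 <= K2 by rewrite addr_ge0 ?divr_ge0.
pose k := 1 + 2 * (K1 + K2); have k1 : 1 <= k by rewrite lerDl; lra.
have k0 : 0 < k by lra.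
exists k; first exact: ltW.
have coef_le a n s : `|a / pos s ^+ n| <= `|a| / t0 ^+ n.
  rewrite normrM normfV normrX (gtr0_norm (pos_gt0 s)) ler_wpM2l//.
  rewrite lef_pV2 ?posrE ?exprn_gt0//.
  by apply: lerXn2r; rewrite ?nnegrE ?pos_ge// ltW.
move=> x y b C cx cy hxy.
have [tb|bt] := leP t0 b; last by move=> s; lra.
have C0 : 0 <= C.
  have := hxy t0; rewrite lexx tb subrr mulr0 expR0 mulr1 => /(_ isT).
  exact: le_trans.
have hmem s : t0 <= s <= b -> `|memory x s - memory y s| <= K1 * C * expR (k * (s - t0)).
  move=> sb; rewrite /memory opprD addrACA -!scalerBr.
  apply: (le_trans (ler_normD _ _)).
  rewrite (normrZ (alpha / pos s ^+ 2)) (normrZ (beta / pos s)).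
  have h1 := ler_wpM2r (normr_ge0 (x s - y s)) (coef_le alpha 2 s).
  have h2 := ler_pM (normr_ge0 _) (normr_ge0 _) (coef_le beta 1 s) (ML' (x s) (y s)).
  rewrite !expr1 in h2; apply: (le_trans (lerD h1 h2)).
  rewrite mulrA -mulrDl -mulrA ler_wpM2l//; exact: hxy.
have hmom s : t0 <= s <= b -> `|momentum x s - momentum y s| <= K1 * C * expR (k * (s - t0)).
  move=> sb; have [ts _] := andP sb; rewrite /momentum posE//.
  rewrite opprD addrACA subrr add0r opprK addrC distrC.
  apply: (primitive_weighted_le k0 _ (memory_continuous cx) (memory_continuous cy)) sb.
    by rewrite mulr_ge0.
  move=> r rb; apply: (le_trans (hmem r rb)); rewrite ler_wpM2r ?expR_ge0//.
  by rewrite ler_peMr// mulr_ge0.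
move=> s sb; have [ts _] := andP sb; rewrite /picard posE// opprD addrACA subrr add0r.
apply: (primitive_weighted_le k0 _ (velocity_continuous cx) (velocity_continuous cy)) sb.
  by rewrite divr_ge0.
move=> r rb; rewrite /velocity.
have -> : momentum x r - M (x r) - (alpha / pos r) *: x r -
    (momentum y r - M (y r) - (alpha / pos r) *: y r) =
    (momentum x r - momentum y r) - (M (x r) - M (y r)) - (alpha / pos r) *: (x r - y r).
  by apply: (ip_ext ipN) => w; rewrite !ipE; ring.
apply: (le_trans (ler_normB _ _)).
have := ler_normB (momentum x r - momentum y r) (M (x r) - M (y r)).
rewrite normrZ; have := coef_le alpha 1 r; rewrite !expr1 => h1.
have h3 := ler_wpM2r (normr_ge0 (x r - y r)) h1.
have := hmom r rb; have := ML' (x r) (y r); have h2 := hxy r rb.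
have e0 := expR_ge0 (k * (r - t0)).
have h4 := ler_wpM2l K20 h2.
have h5 : 0 <= C * expR (k * (r - t0)) by rewrite mulr_ge0.
rewrite /k /K2 in h4 h5 *; move: h2 h3 h4 h5; set E := expR _.
set q := `|alpha| / t0; nra.
Qed.

End IntegralOperator.

(** * Strong solutions *)

Section StrongSolutions.
Context {R : realType} {H : completeNormedModType R}.
Variables (ip : {dot H for idfun}) (ipN : norm_induced_by ip).
Notation mu := (@lebesgue_measure R).
Variables (A : H -> set H) (eta : R) (M : H -> H) (L : R).
Variables (alpha beta t0 : R) (x0 x1 : H).
Hypotheses (AM : forall y, yosida eta A y = [set M y]).
Hypotheses (L_ge0 : 0 <= L) (ML : forall y z, `|M y - M z| <= L * `|y - z|).
Hypothesis t0_gt0 : 0 < t0.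
Variable P : (R -> H) -> R -> H.
Hypothesis P_primitive : forall g, continuous g ->
  P g t0 = 0 /\ forall t, t0 <= t -> is_derive t 1 (P g) (g t).
Implicit Types (x y g : R -> H) (s t b : R).

Let I : set R := `[t0, +oo[%classic.
Let c := x1 + M x0 + (alpha / t0) *: x0.
Let mem := memory M alpha beta t0.
Let mom := momentum M alpha beta t0 c P.
Let vel := velocity M alpha beta t0 c P.
Let picard_map := picard M alpha beta t0 x0 c P.

Let IE t : I t = (t0 <= t). Proof. by rewrite /I /= in_itv/= andbT. Qed.
Let max_t0 t : t0 <= t -> Num.max t t0 = t. Proof. exact: max_l. Qed.

Lemma coef_curve_increment (y : R -> H) u v C : t0 <= u -> u <= v -> `|y u| <= C ->
  `|(alpha / v) *: y v - (alpha / u) *: y u| <=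
  `|alpha| / t0 * `|y v - y u| + `|alpha| * C / t0 ^+ 2 * (v - u).
Proof.
move=> tu uv yC; have u0 : 0 < u by exact: lt_le_trans tu.
have v0 : 0 < v by exact: lt_le_trans uv.
have -> : (alpha / v) *: y v - (alpha / u) *: y u =
    (alpha / v) *: (y v - y u) - (alpha * ((v - u) / (u * v))) *: y u.
  by apply: (ip_ext ipN) => w; rewrite !ipE; field; rewrite !gt_eqF.
apply: (le_trans (ler_normB _ _)).
rewrite (normrZ (alpha / v)) (normrZ (alpha * _)); apply: lerD.
  rewrite ler_wpM2r// normrM normfV (gtr0_norm v0) ler_wpM2l//.
  by rewrite lef_pV2 ?posrE//; exact: le_trans uv.
have vu : 0 <= v - u by rewrite subr_ge0.
rewrite normrM (ger0_norm (divr_ge0 vu (ltW (mulr_gt0 u0 v0)))).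
have h : (v - u) / (u * v) <= (v - u) / t0 ^+ 2.
  rewrite ler_wpM2l// lef_pV2 ?posrE ?mulr_gt0// expr2.
  by apply: ler_pM; rewrite ?(ltW t0_gt0)//; exact: le_trans uv.
rewrite -mulrA -[leRHS]mulrA -mulrA ler_wpM2l//.
rewrite [leLHS]mulrC; apply: ler_pM => //.
  by rewrite divr_ge0// ltW// mulr_gt0.
by apply: (le_trans h); rewrite mulrC.
Qed.

Lemma momentum_is_derive x t : continuous x -> t0 < t ->
  is_derive t 1 (mom x) (- mem x t).
Proof.
move=> cx tt.
have [_ dP] := P_primitive
  (memory_continuous (alpha:=alpha) (beta:=beta) ML t0_gt0 cx).
have d1 : is_derive t 1 (fun s => c - P (mem x) s) (- mem x t).
  have := is_deriveB (is_derive_cst c t 1) (dP t (ltW tt)).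
  by rewrite sub0r.
apply: near_eq_is_derive d1.
have : \forall s \near t, t0 < s by exact: lt_nbhsr.
by apply: filterS => s ts; rewrite /mom /momentum max_t0// ltW.
Qed.

Lemma force_is_derive y t (y' m' : H) : t0 < t -> is_derive t 1 y y' ->
  is_derive t 1 (fun s => M (y s)) m' ->
  is_derive t 1 (fun s => M (y s) + (alpha / s) *: y s)
    (m' + (- (alpha / t ^+ 2) *: y t + (alpha / t) *: y')).
Proof.
move=> tt dy dM; have t_gt0 : 0 < t by exact: lt_trans tt.
have dk : is_derive t 1 (fun s : R => alpha / s) (- (alpha / t ^+ 2)).
  have t_neq0 : t != 0 by rewrite gt_eqF.
  have dV := @is_deriveV R id t 1 1 t_neq0 (is_derive_id _ _).
  apply: is_derive_eq (is_deriveZ alpha dV) _.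
  by rewrite /GRing.scale /=; field.
exact: (is_deriveD dM (is_derive_scale ipN dk dy)).
Qed.

Section Existence.
Variable x : R -> H.
Hypotheses (cx : continuous x) (x_fix : forall t, t0 <= t -> picard_map x t = x t).

Let X t := x0 + P (vel x) t.

Let cvel : continuous (vel x).
Proof. exact: (velocity_continuous ML t0_gt0 P_primitive). Qed.

Let cmem : continuous (mem x).
Proof. exact: (memory_continuous ML t0_gt0). Qed.

Let XE t : t0 <= t -> X t = x t.
Proof. by move=> tt; rewrite -x_fix// /picard_map /picard max_t0. Qed.

Let dX t : t0 <= t -> is_derive t 1 X (vel x t).
Proof.
move=> tt; have := is_deriveD (is_derive_cst x0 t 1) ((P_primitive cvel).2 t tt).
by rewrite add0r.
Qed.

Let dXE t : t0 <= t -> derivable_on I X t /\ derive_on I X t = vel x t.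
Proof. by move=> tt; apply: derive_on_half_line => //; exact: dX. Qed.

Let velE t : t0 <= t -> vel x t = mom x t - (M (X t) + (alpha / t) *: X t).
Proof.
by move=> tt; rewrite /vel /velocity -XE// max_t0// opprD addrA.
Qed.

Let X_lipschitz b : exists2 K, 0 <= K & forall u v, t0 <= u -> u <= v -> v <= b ->
  `|X v - X u| <= K * (v - u).
Proof.
have [K K0 hK] := primitive_lipschitz ipN P_primitive b cvel.
exists K => // u v tu uv vb; rewrite /X opprD addrACA subrr add0r.
exact: hK.
Qed.

Let dX_lipschitz b : exists2 K, 0 <= K & forall u v, t0 <= u -> u <= v -> v <= b ->
  `|derive_on I X v - derive_on I X u| <= K * (v - u).
Proof.
have [K1 K10 hK1] := primitive_lipschitz ipN P_primitive b cmem.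
have [K2 K20 hK2] := X_lipschitz b.
have [C C0 hC] := continuous_bounded t0 b cx.
exists (K1 + L * K2 + `|alpha| / t0 * K2 + `|alpha| * C / t0 ^+ 2).
  by rewrite !addr_ge0 ?mulr_ge0 ?invr_ge0 ?exprn_ge0// ltW.
move=> u v tu uv vb; have tv := le_trans tu uv.
rewrite (dXE tu).2 (dXE tv).2 !velE//.
have -> : mom x v - (M (X v) + (alpha / v) *: X v) -
    (mom x u - (M (X u) + (alpha / u) *: X u)) =
  - (P (mem x) v - P (mem x) u) - (M (X v) - M (X u)) -
    ((alpha / v) *: X v - (alpha / u) *: X u).
  rewrite /mom /momentum !max_t0//.
  by apply: (ip_ext ipN) => w; rewrite !ipE; ring.
apply: (le_trans (ler_normB _ _)).
have Xu : `|X u| <= C by rewrite XE//; apply: hC; rewrite tu (le_trans uv).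
have h1 := coef_curve_increment tu uv Xu.
have h2 := le_trans (ML (X v) (X u)) (ler_wpM2l L_ge0 (hK2 u v tu uv vb)).
have h3 := ler_normB (- (P (mem x) v - P (mem x) u)) (M (X v) - M (X u)).
rewrite normrN in h3; have h4 := hK1 u v tu uv vb.
have a0 : 0 <= `|alpha| / t0 by rewrite divr_ge0// ltW.
have h5 := ler_wpM2l a0 (hK2 u v tu uv vb).
by move: h1 h2 h3 h4 h5; rewrite !mulrDl !mulrA; lra.
Qed.

Let X_solves t m' : t0 < t -> is_derive t 1 (fun s => M (X s)) m' ->
  solves_system A eta alpha beta t0 X (fun s => M (X s)) t.
Proof.
move=> tt dM; have tt' := ltW tt.
have d1 := is_deriveB (momentum_is_derive cx tt) (force_is_derive tt (dX tt') dM).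
have d2 : is_derive t 1 (derive_on I X)
  (- mem x t - (m' + (- (alpha / t ^+ 2) *: X t + (alpha / t) *: vel x t))).
  apply: near_eq_is_derive d1.
  have : \forall s \near t, t0 < s by exact: lt_nbhsr.
  by apply: filterS => s ts; rewrite (dXE (ltW ts)).2 velE// ltW.
have [dd dE] := derive_on_half_line tt' d2.
have [dm mE] := derive_on_half_line tt' dM.
split => //; rewrite -/I dE mE (dXE tt').2 /mem /memory max_t0// -XE//.
apply: (ip_ext ipN) => w; rewrite !ipE ip0l; ring.
Qed.

(* The curve is globally Lipschitz once time is clamped to [[t0, b]]. *)
Let MX_ae_derivable n :
  mu.-negligible (`]t0, t0 + n.+1%:R[ `&` [set t | ~ derivable (fun s => M (X s)) t 1]).
Proof.
pose b : R := t0 + n.+1%:R; have tb : t0 <= b by rewrite ler_wpDr.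
pose cl s := Num.min (Num.max s t0) b.
have [K K0 hK] := X_lipschitz b.
have cl_in s : t0 <= cl s /\ cl s <= b.
  by rewrite le_min ge_min le_max !lexx orbT tb orbT.
have fL s t : `|M (X (cl t)) - M (X (cl s))| <= L * K * `|t - s|.
  apply: (le_trans (ML _ _)); rewrite -mulrA ler_wpM2l//.
  apply: (@le_trans _ _ (K * `|cl t - cl s|)); last first.
    rewrite ler_wpM2l//; apply: (le_trans (min_lipschitz _ _ _)).
    exact: max_lipschitz.
  have [cs1 cs2] := cl_in s; have [ct1 ct2] := cl_in t.
  have [st|ts] := leP (cl s) (cl t).
    by rewrite ger0_norm ?subr_ge0//; exact: hK.
  by rewrite distrC ltr0_norm ?subr_lt0// opprB; apply: hK => //; exact: ltW.
apply: negligibleS (lipschitz_ae_derivable ipN fL tb) => t [tab nd]; split => //.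
apply: contra_not nd; apply: near_eq_derivable.
move: tab; rewrite /= in_itv/= => /andP[t0t tb'].
have h1 : \forall s \near t, t0 < s by exact: lt_nbhsr.
have h2 : \forall s \near t, s < b by exact: lt_nbhsl.
apply: filterS2 h1 h2 => s ts sb.
by rewrite /cl max_t0 ?(ltW ts)// min_l// ltW.
Qed.

Lemma fixpoint_strong_solution : strong_global_solution A eta alpha beta t0 x0 x1 X.
Proof.
have X0 : X t0 = x0 by rewrite /X (P_primitive cvel).1 addr0.
split.
- move=> b tb; have [K _ hK] := X_lipschitz b.
  exact: lipschitz_abs_continuous hK.
- by move=> t; rewrite /= in_itv/= andbT => /dXE[].
- move=> b tb; have [K _ hK] := dX_lipschitz b.
  exact: lipschitz_abs_continuous hK.
- exists (fun s => M (X s)).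
  have : mu.-negligible ([set t0] `|` \bigcup_n
      (`]t0, t0 + n.+1%:R[ `&` [set t | ~ derivable (fun s => M (X s)) t 1])).
    apply: negligibleU; last by apply: negligible_bigcup; exact: MX_ae_derivable.
    by apply/negligibleP => //; exact: lebesgue_measure_set1.
  apply: negligibleS => t /=; apply: contra_notP => /not_orP[tt0 nt].
  rewrite in_itv/= andbT le_eqVlt => /predU1P[/esym//|tt].
  have dM : derivable (fun s => M (X s)) t 1.
    apply: contrapT => nd; apply: nt.
    exists (Num.truncn (t - t0)) => //; split => //=; rewrite in_itv/= tt /=.
    by rewrite -ltrBlDl truncnS_gt.
  by apply: (X_solves tt); exact: derivableP dM.
- split=> //; rewrite (dXE (lexx t0)).2 velE// X0 /mom /momentum max_t0// (P_primitive cmem).1.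
  by rewrite subr0 /c -[x1 + _ + _]addrA addrK.
Qed.

End Existence.

Section Uniqueness.
Variable y : R -> H.
Hypothesis y_sol : strong_global_solution A eta alpha beta t0 x0 x1 y.

Let yhat t := y (Num.max t t0).
Let dy := derive_on I y.

Let y_ac : locally_abs_continuous t0 y. Proof. by case: y_sol. Qed.
Let dy_ac : locally_abs_continuous t0 dy. Proof. by case: y_sol. Qed.
Let y_derivable t : t0 <= t -> derivable_on I y t.
Proof. by move=> tt; case: y_sol => _ + _ _ _; apply; rewrite /= in_itv/= andbT. Qed.

Let cy : continuous yhat. Proof. exact: locally_abs_continuous_clamp. Qed.

Let yhatE t : t0 <= t -> yhat t = y t.
Proof. by move=> tt; rewrite /yhat max_t0. Qed.

Let y_is_derive t : t0 < t -> is_derive t 1 y (dy t).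
Proof.
by move=> tt; apply: is_derive_of_derivable_on => //; exact/y_derivable/ltW.
Qed.

Let cmem : continuous (mem yhat).
Proof. exact: (memory_continuous ML t0_gt0). Qed.

Let cvel : continuous (vel yhat).
Proof. exact: (velocity_continuous ML t0_gt0 P_primitive). Qed.

Let My_continuous t : t0 < t -> {for t, continuous (fun s => M (y s))}.
Proof.
move=> tt; apply: (continuous_comp _ (lipschitz_continuous ML (x:=y t))).
exact: is_derive_continuous (y_is_derive tt).
Qed.

(* The difference of the two sides of the equation integrated once. *)
Let W s := dy s + (M (y s) + (alpha / s) *: y s) - mom yhat s.

Let W_ac b : t0 <= b -> abs_continuous t0 b W.
Proof.
move=> tb; have [K K0 hK] := primitive_lipschitz ipN P_primitive b cmem.
have [C C0 hC] := continuous_bounded t0 b cy.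
pose D := 1 + L + `|alpha| / t0 + `|alpha| * C / t0 ^+ 2 + K.
have a0 : 0 <= `|alpha| / t0 by rewrite divr_ge0// ltW.
have c0 : 0 <= `|alpha| * C / t0 ^+ 2.
  by rewrite divr_ge0 ?mulr_ge0// ltW.
have D0 : 0 <= D by rewrite !addr_ge0.
apply: (abs_continuous_dominated D0 (dy_ac tb) (y_ac tb)) => u v tu uv vb.
have tv := le_trans tu uv.
have -> : W v - W u = (dy v - dy u) + (M (y v) - M (y u)) +
    ((alpha / v) *: y v - (alpha / u) *: y u) + (P (mem yhat) v - P (mem yhat) u).
  rewrite /W /mom /momentum !max_t0//.
  by apply: (ip_ext ipN) => w; rewrite !ipE; ring.
apply: (le_trans (ler_normD _ _)).
have yu : `|y u| <= C by rewrite -yhatE//; apply: hC; rewrite tu (le_trans uv).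
have h1 := coef_curve_increment tu uv yu.
have h2 := ML (y v) (y u); have h3 := hK u v tu uv vb.
have h4 := ler_normD (dy v - dy u + (M (y v) - M (y u)))
  ((alpha / v) *: y v - (alpha / u) *: y u).
have h5 := ler_normD (dy v - dy u) (M (y v) - M (y u)).
have n1 := normr_ge0 (dy v - dy u); have n2 := normr_ge0 (y v - y u).
have n3 : 0 <= v - u by rewrite subr_ge0.
rewrite /D; move: a0 c0 h1 h2 h3 h4 h5.
move: (`|alpha| / t0) (`|alpha| * C / t0 ^+ 2) => p q p0 q0 h1 h2 h3 h4 h5.
have g1 : 0 <= (L + p + q + K) * `|dy v - dy u| by rewrite mulr_ge0// !addr_ge0.
have g2 : 0 <= (1 + q + K) * `|y v - y u| by rewrite mulr_ge0// !addr_ge0.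
have g3 : 0 <= (1 + L + p) * (v - u) by rewrite mulr_ge0// !addr_ge0.
lra.
Qed.

(* The equation gives the derivative of [m], which agrees with [M y] only
   almost everywhere; [is_derive_ae_eq] transfers it to [M y]. *)
Let W_derive0 b : mu.-negligible [set t | t0 < t < b /\ ~ is_derive t 1 W 0].
Proof.
case: y_sol => _ _ _ [m hm] _.
pose N := ~` [set t | I t -> solves_system A eta alpha beta t0 y m t].
have nN : mu.-negligible N by exact: hm.
apply: negligibleS (nN) => t [/andP[tt _]] nd /= sol; apply: nd.
have solE s : t0 < s -> ~ N s -> solves_system A eta alpha beta t0 y m s.
  by move=> ts /contrapT; apply; rewrite IE ltW.
have mE s : t0 < s -> ~ N s -> m s = M (y s).
  move=> ts /(solE _ ts)[E _ _ _]; move: E; rewrite AM => E.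
  by have : [set m s] (M (y s)) by rewrite -E.
have [_ ddy dm eq] := solE t tt (fun h => h sol).
have mtE := mE t tt (fun h => h sol).
have dM := is_derive_ae_eq nN tt mE mtE My_continuous (is_derive_of_derivable_on tt dm).
have d2y := is_derive_of_derivable_on tt ddy.
have dW := is_deriveB (is_deriveD d2y (force_is_derive tt (y_is_derive tt) dM))
  (momentum_is_derive cy tt).
apply: is_derive_eq dW _.
move: eq; rewrite mtE -/I -/dy /mem /memory yhatE ?ltW// max_t0 ?ltW// => eq.
rewrite -[RHS]eq; apply: (ip_ext ipN) => w; rewrite !ipE; ring.
Qed.

Let dyE t : t0 <= t -> dy t = vel yhat t.
Proof.
move=> tt; have WE := abs_continuous_derive0 tt (W_ac tt) (@W_derive0 t).
have [y0 y1] : y t0 = x0 /\ dy t0 = x1 by case: y_sol.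
have W0 : W t0 = 0.
  rewrite /W y0 y1 /mom /momentum max_t0// (P_primitive cmem).1 subr0 addrA.
  by rewrite subrr.
move/eqP: WE; rewrite W0 /W subr_eq0 => /eqP dyE.
by rewrite /vel /velocity -/mom -dyE yhatE// max_t0// !addrA addrAC addrK addrK.
Qed.

(** Since [W] vanishes identically, the derivative of [y] is the velocity
    computed from [y] alone, and integrating it gives [y] back. *)
Lemma strong_solution_fixpoint t : t0 <= t -> picard_map yhat t = yhat t.
Proof.
move=> tt; have [y0 _] : y t0 = x0 /\ dy t0 = x1 by case: y_sol.
have [P0 dP] := P_primitive cvel.
have cf : {within `[t0, t], continuous (fun s => yhat s - P (vel yhat) s)}.
  move=> s; apply: cvgB; first exact: (continuous_subspaceT cy).
  exact: (primitive_continuous_on (t0:=t0) P_primitive).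
have c0 : {within `[t0, t], continuous (fun _ : R => 0 : R)}.
  by apply: continuous_subspaceT => s; exact: cvg_cst.
have := mean_value_inequality ipN tt cf c0.
move=> /(_ (fun=> 0) (fun=> 0)); rewrite P0 subr0 subrr (yhatE (lexx t0)) y0 => h.
have : `|yhat t - P (vel yhat) t - x0| <= 0.
  apply: h => s /andP[ts st]; rewrite normr0; split => //; last exact: is_derive_cst.
  have dyh : is_derive s 1 yhat (dy s).
    apply: near_eq_is_derive (y_is_derive ts).
    have : \forall r \near s, t0 < r by exact: lt_nbhsr.
    by apply: filterS => r tr; rewrite yhatE// ltW.
  apply: is_derive_eq (is_deriveB dyh (dP s (ltW ts))) _.
  by rewrite dyE ?subrr// ltW.
rewrite normr_le0 subr_eq0 subr_eq => /eqP E.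
by rewrite /picard_map /picard max_t0// E.
Qed.

End Uniqueness.

End StrongSolutions.

Unset Implicit Arguments.

Theorem theorem3p1 (R : realType) (H : completeNormedModType R)
    (ip : {dot H for idfun}) (ip_norm : norm_induced_by ip)
    (rho : R) (A : H -> set H)
    (A_max : maximally_comonotone ip rho A) (zerA : zer A !=set0)
    (eta : R) (eta_gt : Num.max (- 2 * rho) 0 < eta)
    (alpha beta t0 : R) (t0_gt0 : 0 < t0) (x0 x1 : H) :
  exists2 x : R -> H, strong_global_solution A eta alpha beta t0 x0 x1 x &
    forall y : R -> H, strong_global_solution A eta alpha beta t0 x0 x1 y ->
      forall t, t0 <= t -> y t = x t.
Proof.
have [z Az] := zerA.
have [M AM ML] := yosida_lipschitz ip_norm A_max (ex_intro _ z (ex_intro _ 0 Az)) eta_gt.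
have L_ge0 : 0 <= (rho + eta)^-1.
  by move: eta_gt; rewrite gt_max => /andP[? ?]; rewrite invr_ge0; lra.
have [P P_primitive] := exists_primitive ip_norm t0.
pose c := x1 + M x0 + (alpha / t0) *: x0.
pose T := picard M alpha beta t0 x0 c P.
have Tc x : continuous x -> continuous (T x).
  exact: (picard_continuous ML t0_gt0 P_primitive).
have [k k0 Tk] := picard_halving ip_norm alpha beta x0 c ML t0_gt0 P_primitive.
have [x cx Tx] := weighted_fixpoint_exists k0 Tc Tk.
exists (fun t => x0 + P (velocity M alpha beta t0 c P x) t).
  exact: (fixpoint_strong_solution ip_norm AM L_ge0 ML t0_gt0 P_primitive cx Tx).
move=> y y_sol t tt.
have cyhat : continuous (fun s => y (Num.max s t0)).
  by apply: locally_abs_continuous_clamp; case: y_sol.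
have Ty := strong_solution_fixpoint ip_norm AM L_ge0 ML t0_gt0 P_primitive y_sol.
have := weighted_fixpoint_unique k0 Tk cx cyhat Tx Ty tt.
by rewrite max_l// => <-; rewrite -Tx// /T /picard max_l.
Qed.
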